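(* Let $\beta_0,h_0\in\mathbb R$ be fixed, let $X\sim P_{\beta_0,h_0}$, and suppose there is a finite constant $\gamma>0$ (independent of $N$) with $\max_{i\in[N]}\sum_{j,k}A_{ijk}\le\gamma$ for all $N$. Assume that either $\mathrm{Tr}(\mathcal R^2)=\Omega(N)$ or $\sum_i(\mathcal R_i-\bar{\mathcal R})^2=\Omega(N)$. If $\Lambda'(h_0)\neq0$, then $$T_N(X)=\Omega_p(1),$$ and consequently the maximum pseudo-likelihood estimator $(\hat\beta,\hat h)$ is $\sqrt N$-consistent for $(\beta_0,h_0)$.
   Context: Setting. $\kappa_-<\kappa_+$ are real numbers, $\mu$ is a fixed probability measure on $[\kappa_-,\kappa_+]$ with $\kappa_-,\kappa_+\in\mathrm{supp}(\mu)$, and $\Lambda(\lambda)=\log\int e^{\lambda z}\,d\mu(z)$ for $\lambda\in\mathbb R$. For each $N$, $A=A^{(N)}=(A_{ijk})_{i,j,k\in[N]}$ is a 3-tensor with nonnegative entries, invariant under permutations of its indices, with $A_{ijk}=0$ unless $i,j,k$ are all distinct. For $\beta,h\in\mathbb R$, $P_{\beta,h}$ is the probability measure on $[\kappa_-,\kappa_+]^N$ with density $$\frac{dP_{\beta,h}}{d\mu^{\otimes N}}(x)=\frac{e^{f(x)}}{Z_N(\beta,h)},\qquad f(x)=\frac{\beta}{3}\sum_{i,j,k}A_{ijk}x_ix_jx_k+h\sum_i x_i,$$ where $Z_N(\beta,h)$ is the normalizing constant. Put $m_i(x)=\sum_{j,k}A_{ijk}x_jx_k$, $\bar m(x)=\frac1N\sum_i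 m_i(x)$, $T_N(x)=\frac1N\sum_i(m_i(x)-\bar m(x))^2$. Also $\mathcal R_{ij}=\sum_kA_{ijk}$ (with $\mathcal R=(\mathcal R_{ij})$ the corresponding symmetric $N\times N$ matrix), $\mathcal R_i=\sum_{j,k}A_{ijk}$, $\bar{\mathcal R}=\frac1N\sum_i\mathcal R_i$. Maximum pseudo-likelihood estimator (MPLE): given $x$, $(\hat\beta,\hat h)$ is the unique solution $(\beta,h)\in\mathbb R^2$ of $$\sum_i m_i(x)\big(x_i-\Lambda'(\beta m_i(x)+h)\big)=0,\qquad \sum_i\big(x_i-\Lambda'(\beta m_i(x)+h)\big)=0;$$ it is said to exist if such a unique solution exists. It is $\sqrt N$-consistent if it exists with probability tending to one and $\max(|\hat\beta-\beta_0|,|\hat h-h_0|)=O_p(N^{-1/2})$ under $P_{\beta_0,h_0}$. $a_N=\Omega(N)$ means $\liminf_N a_N/N>0$. $T_N(X)=\Omega_p(1)$ means $P_{\beta_0,h_0}(T_N(X)\le\varepsilon_N)\to0$ for every deterministic sequence $\varepsilon_N\to0$. All asymptotics are as $N\to\infty$. *)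

(* Defs.v *)
From HB Require Import structures.
From mathcomp Require Import all_boot all_order all_algebra.
From mathcomp Require Import all_classical all_reals all_analysis.

Set Implicit Arguments.
Unset Strict Implicit.
Unset Printing Implicit Defensive.

Import Order.TTheory GRing.Theory Num.Theory.
Import numFieldNormedType.Exports.

Local Open Scope classical_set_scope.
Local Open Scope ring_scope.

(** * Product measures on tuples *)

Section product_probability.
Local Open Scope ereal_scope.
Context d1 d2 (T1 : measurableType d1) (T2 : measurableType d2) (R : realType).
Variables (P : probability T1 R) (Q : probability T2 R).

Definition product_prob : set (T1 * T2) -> \bar R := P \x Q.

HB.instance Definition _ := Measure.on product_prob.

Let product_prob_setT : product_prob [set: T1 * T2] = 1.
Proof.
rewrite -setXTT [LHS]product_measure1E//.
by rewrite [X in X * _](@probability_setT _ _ _ P)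
  [X in _ * X](@probability_setT _ _ _ Q) mule1.
Qed.

HB.instance Definition _ :=
  Measure_isProbability.Build _ _ _ product_prob product_prob_setT.

End product_probability.

Section cons_mfun.
Context d (T : measurableType d) (n : nat).

Definition tuple_cons (x : T * n.-tuple T) : n.+1.-tuple T := [tuple of x.1 :: x.2].

Let measurable_tuple_cons : measurable_fun setT tuple_cons.
Proof. exact: measurable_cons. Qed.

HB.instance Definition _ :=
  isMeasurableFun.Build _ _ _ _ tuple_cons measurable_tuple_cons.

End cons_mfun.

(* mu^{\otimes n}: the law of x_0 :: (x_1, ..., x_n.-1) under mu \x mu^{\otimes n.-1} *)
Fixpoint prob_power d (T : measurableType d) (R : realType)
    (mu : probability T R) (n : nat) : probability (n.-tuple T) R :=
  if n is m.+1 then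
    distribution (product_prob mu (prob_power mu m)) (@tuple_cons d T m)
  else \d_([tuple] : 0.-tuple T).

Lemma prob_power_box d (T : measurableType d) (R : realType)
    (mu : probability T R) (n : nat) (B : 'I_n -> set T) :
  (forall i, measurable (B i)) ->
  prob_power mu n [set x | forall i, B i (tnth x i)] =
  (\prod_(i < n) mu (B i))%E.
Proof.
elim: n B => [|n IH] B mB.
  by rewrite big_ord0 /= diracE mem_set// => -[].
rewrite big_ord_recl -IH//=.
rewrite /distribution /pushforward/= /product_prob.
rewrite -product_measure1E//; last first.
  rewrite (_ : [set _ | _] =
    \bigcap_(i in [set: 'I_n]) ((@tnth n T)^~ i @^-1` B (lift ord0 i))).
    apply: fin_bigcap_measurable; first exact: finite_finset.
    by move=> i _; rewrite -[X in measurable X]setTI; exact: measurable_tnth.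
  by apply/seteqP; split=> [x Bx i _|x Bx i]; [exact: Bx|exact: (Bx i I)].
congr (_ _); apply/seteqP; split => [[x t] /= Bxt|[x t] /= [Bx Bt] i].
  split; first by have := Bxt ord0; rewrite (tnth_nth x).
  by move=> i; have := Bxt (lift ord0 i); rewrite tnthS.
by case: (unliftP ord0 i) => [j ->|->]; [rewrite tnthS|rewrite (tnth_nth x)].
Qed.

(** * The base measure *)

Section base_measure.
Context (R : realType).
Implicit Type mu : probability (measurableTypeR R) R.

Definition measure_supp mu : set R :=
  [set x | forall U : set R, open U -> U x -> (0 < mu U)%E].

Definition Lambda mu (l : R) : R := ln (\int[mu]_z expR (l * z)).

End base_measure.

(** * The tensor Gibbs model *)

Section model.
Context (R : realType) (N : nat).
Implicit Types (A : 'I_N -> 'I_N -> 'I_N -> R) (x : N.-tuple R) (b h : R).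
Implicit Type mu : probability (measurableTypeR R) R.

(* The transpositions (i j) and (j k) generate all permutations of the indices. *)
Definition coupling_tensor A : Prop :=
  [/\ forall i j k, 0 <= A i j k,
      forall i j k, A i j k = A j i k,
      forall i j k, A i j k = A i k j &
      forall i j k, ~~ [&& i != j, j != k & i != k] -> A i j k = 0].

Definition hamiltonian A b h x : R :=
  b / 3 * (\sum_i \sum_j \sum_k A i j k * tnth x i * tnth x j * tnth x k)
  + h * \sum_i tnth x i.

Definition partition_fun mu A b h : R :=
  \int[prob_power mu N]_x expR (hamiltonian A b h x).

(* On a set E that is not known to be measurable this is the lower integral,
   hence the inner probability of E. *)
Definition gibbs mu A b h (E : set (N.-tuple (measurableTypeR R))) : \bar R :=
  (\int[prob_power mu N]_(x in E)
     (expR (hamiltonian A b h x) / partition_fun mu A b h)%:E)%E.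

Definition local_field A x (i : 'I_N) : R :=
  \sum_j \sum_k A i j k * tnth x j * tnth x k.

Definition mean_field A x : R := N%:R^-1 * \sum_i local_field A x i.

Definition T_stat A x : R :=
  N%:R^-1 * \sum_i (local_field A x i - mean_field A x) ^+ 2.

Definition row_mass2 A : 'M[R]_N := \matrix_(i, j) \sum_k A i j k.

Definition row_mass1 A (i : 'I_N) : R := \sum_j \sum_k A i j k.

Definition mean_row_mass1 A : R := N%:R^-1 * \sum_i row_mass1 A i.

Definition pseudo_likelihood_eqs mu A x b h : Prop :=
  \sum_i local_field A x i *
    (tnth x i - derive1 (Lambda mu) (b * local_field A x i + h)) = 0 /\
  \sum_i (tnth x i - derive1 (Lambda mu) (b * local_field A x i + h)) = 0.

Definition is_mple mu A x b h : Prop :=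
  pseudo_likelihood_eqs mu A x b h /\
  forall b' h', pseudo_likelihood_eqs mu A x b' h' -> b' = b /\ h' = h.

End model.

(** * Asymptotics along a sequence of tensors *)

Section asymptotics.
Context (R : realType).
Implicit Type mu : probability (measurableTypeR R) R.
Implicit Type A : forall N, 'I_N -> 'I_N -> 'I_N -> R.

Definition Omega_linear (a : nat -> R) : Prop :=
  (0 < limn_einf (fun N => (a N / N%:R)%:E))%E.

Definition T_stat_Omega_p mu A b0 h0 : Prop :=
  forall eps : nat -> R, eps @ \oo --> (0 : R) ->
    gibbs mu (A N) b0 h0 [set x | T_stat (A N) x <= eps N] @[N --> \oo]
      --> (0 : \bar R)%E.

(* Samples without an MPLE count against the O_p bound; as existence has
   probability tending to one this does not change its meaning. *)
Definition mple_sqrt_consistent mu A b0 h0 : Prop :=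
  gibbs mu (A N) b0 h0 [set x | exists b h, is_mple mu (A N) x b h] @[N --> \oo]
    --> (1 : \bar R)%E /\
  forall delta : R, 0 < delta -> exists M : R, \forall N \near \oo,
    ((1 - delta)%:E <= gibbs mu (A N) b0 h0
       [set x | exists b h, is_mple mu (A N) x b h /\
          (Num.max `|b - b0| `|h - h0| <= M / Num.sqrt N%:R)%R])%E.

End asymptotics.

(* Main.v *)
Require Import Defs.
From mathcomp Require Import all_boot all_order all_algebra.
From mathcomp Require Import all_classical all_reals all_analysis.
From mathcomp Require Import measurable_realfun.
From mathcomp Require Import ring lra.
Set Implicit Arguments.
Unset Strict Implicit.
Unset Printing Implicit Defensive.
Import Order.TTheory GRing.Theory Num.Theory.
Import numFieldNormedType.Exports.
Local Open Scope classical_set_scope.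
Local Open Scope ring_scope.

(* Given the other coordinates, x_k has the law of mu tilted by b m_k + h, so the
   residuals x_k^p - E[x_k^p | rest] satisfy E (sum_k resid_k g_k)^2 = O(N) for
   coefficients g_k that do not involve x_k and depend weakly on each other
   coordinate. If T_N is small, all m_k are close to their mean mbar, and up to
   errors O(sqrt T_N) + O_p(N^-1/2) averages of x_k^p g_k can be computed as if the
   x_k were i.i.d. from mu tilted by theta = b mbar + h, with mean c and variance v.
   This gives mbar = c^2 Rbar, c^2 (1/N) sum_i (R_i - Rbar)^2 = 0 and
   v c Tr(R^2) / N = 0 approximately. Either degree assumption forces c = 0, hence
   mbar = 0 and theta = h, so Lambda'(h) = c = 0: a contradiction. Thus T_N exceeds
   a fixed constant with probability 1 - O(1/N).
   For the MPLE, T_N bounded below makes the concave log-pseudo-likelihood uniformly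
   strongly concave near (b, h), where its gradient is O_p(sqrt N); hence its
   maximum over a box of radius M / sqrt N is interior and is the unique critical
   point. *)

(** No smallness of [b] is assumed, so [mbar] is not known to concentrate, and [theta], [c] and [v]
    depend on the sample. The argument is therefore deterministic sample by sample: for
    nondegeneracy, randomness enters only through [test_stat], a sum of eight squared residual sums
    with mean O(N), and all constants are fixed before [N] and [A]. The trace relation comes from
    pairing m_i with a_i = sum_l r_il (x_l - c), where r_il is an entry of R. As the m_i are nearly
    constant, avg(m_i a_i) is close to mbar avg(a_i), which is close to 0. Exchanging sums, it is
    also the average over l of (x_l - c) sum_i r_il m_i. The obstacle is that this inner sum
    involves x_l itself, linearly: it equals q_l + 2 x_l s_l with q_l and s_l free of x_l. The q_l
    part averages out; the rest averages to about 2 v avg(s_l), and avg(s_l) is about c Tr(R^2) / N.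
    This self-interaction is the source of the factor v and the reason for residuals of x_k^2. The
    event that the MPLE exists is not shown to be measurable; it is bounded below through a
    measurable event of good samples. *)

Section bounded_on_full_set.
Context d (T : measurableType d) (R : realType) (P : probability T R).
Variable B : set T.
Hypotheses (mB : measurable B) (PB : P B = 1%E).

(** Tuples range over all of R^N, while Hamiltonians and densities are bounded only on the cube that
    carries the mass. Boundedness on a set of probability one suffices for integrability and is
    stable under the algebra used below. *)
Definition bmf (f : T -> R) : Prop :=
  measurable_fun setT f /\ exists C, forall x, B x -> `|f x| <= C.

Lemma bmf_cst (c : R) : bmf (fun=> c).
Proof. by split; [exact: measurable_cst|exists `|c|]. Qed.

Lemma bmfD f g : bmf f -> bmf g -> bmf (fun x => f x + g x).
Proof.
move=> [mf [C fC]] [mg [D gD]]; split; first exact: measurable_funD.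
by exists (C + D) => x Bx; rewrite (le_trans (ler_normD _ _))// lerD ?fC ?gD.
Qed.

Lemma bmfM f g : bmf f -> bmf g -> bmf (fun x => f x * g x).
Proof.
move=> [mf [C fC]] [mg [D gD]]; split; first exact: measurable_funM.
by exists (C * D) => x Bx; rewrite normrM ler_pM ?fC ?gD.
Qed.

Lemma bmfN f : bmf f -> bmf (fun x => - f x).
Proof.
move=> [mf [C fC]]; split; first exact: measurableT_comp.
by exists C => x Bx; rewrite normrN fC.
Qed.

Lemma bmfB f g : bmf f -> bmf g -> bmf (fun x => f x - g x).
Proof. by move=> bf bg; apply: bmfD => //; exact: bmfN. Qed.

Lemma bmfX f n : bmf f -> bmf (fun x => f x ^+ n).
Proof.
move=> bf; elim: n => [|n IH].
  by under eq_fun do rewrite expr0; exact: bmf_cst.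
by under eq_fun do rewrite exprS; exact: bmfM.
Qed.

Lemma bmf_sum (I : Type) (r : seq I) (p : pred I) (F : I -> T -> R) :
  (forall i, bmf (F i)) -> bmf (fun x => \sum_(i <- r | p i) F i x).
Proof.
move=> bF; elim: r => [|i r IH].
  by under eq_fun do rewrite big_nil; exact: bmf_cst.
under eq_fun do rewrite big_cons.
by case: (p i) => //; exact: bmfD.
Qed.

Lemma bmf_expR f : bmf f -> bmf (fun x => expR (f x)).
Proof.
move=> [mf [C fC]]; split; first exact: measurableT_comp.
exists (expR C) => x Bx; rewrite ger0_norm ?expR_ge0// ler_expR.
by rewrite (le_trans (ler_norm _))// fC.
Qed.

Lemma bmf_indic A : measurable A -> bmf (\1_A : T -> R).
Proof.
move=> mA; split; first exact: measurable_indic.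
by exists 1 => x _; rewrite indicE; case: (_ \in _); rewrite ?normr1 ?normr0.
Qed.

Let mBC : measurable (~` B). Proof. exact: measurableC. Qed.

Let PBC : P (~` B) = 0%E.
Proof. by rewrite probability_setC// PB subee. Qed.

Lemma integral_full (f : T -> \bar R) : measurable_fun setT f ->
  (\int[P]_x f x = \int[P]_(x in B) f x)%E.
Proof.
move=> mf; rewrite [RHS]integral_mkcond.
apply: ae_eq_integral => //=.
  by apply/(measurable_restrictT f mB); exact: measurable_funTS.
exists (~` B); split => // x /= nfx Bx; apply: nfx => _.
by rewrite patchE mem_set.
Qed.

Lemma bmf_integrable f : bmf f -> P.-integrable setT (EFin \o f).
Proof.
move=> [mf [C fC]]; apply/integrableP; split; first exact/measurable_EFinP.
rewrite integral_full//; last by do 2 apply: measurableT_comp => //.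
apply: (@le_lt_trans _ _ (\int[P]_(x in B) (`|C|)%:E)%E).
  apply: ge0_le_integral => //=.
  - apply: measurable_funTS; do 2 apply: measurableT_comp => //.
  - by move=> x Bx; rewrite lee_fin (le_trans (fC _ Bx))// ler_norm.
by rewrite integral_cst// [X in (_ * X)%E]PB mule1 ltry.
Qed.

Lemma integrable_full f : bmf f -> P.-integrable B (EFin \o f).
Proof. by move=> /bmf_integrable; exact: integrableS. Qed.

Lemma Rintegral_full f : bmf f -> \int[P]_x f x = \int[P]_(x in B) f x.
Proof.
by move=> [mf _]; rewrite /Rintegral integral_full//; exact/measurable_EFinP.
Qed.

Lemma le_int f g : bmf f -> bmf g -> (forall x, B x -> f x <= g x) ->
  \int[P]_x f x <= \int[P]_x g x.
Proof.
move=> bf bg fg; rewrite !Rintegral_full//.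
by apply: le_Rintegral => //; exact: integrable_full.
Qed.

Lemma int_cst (c : R) : \int[P]_x c = c.
Proof.
by rewrite Rintegral_cst// [X in fine X](@probability_setT _ _ _ P) mulr1.
Qed.

Lemma intD f g : bmf f -> bmf g ->
  \int[P]_x (f x + g x) = \int[P]_x f x + \int[P]_x g x.
Proof. by move=> bf bg; rewrite RintegralD//; exact: bmf_integrable. Qed.

Lemma intB f g : bmf f -> bmf g ->
  \int[P]_x (f x - g x) = \int[P]_x f x - \int[P]_x g x.
Proof. by move=> bf bg; rewrite RintegralB//; exact: bmf_integrable. Qed.

Lemma intZl (c : R) f : bmf f -> \int[P]_x (c * f x) = c * \int[P]_x f x.
Proof. by move=> bf; rewrite RintegralZl//; exact: bmf_integrable. Qed.

Lemma int_sum (I : Type) (r : seq I) (F : I -> T -> R) :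
  (forall i, bmf (F i)) ->
  \int[P]_x (\sum_(i <- r) F i x) = \sum_(i <- r) \int[P]_x F i x.
Proof.
move=> bF; elim: r => [|i r IH].
  by under eq_Rintegral do rewrite big_nil; rewrite big_nil int_cst.
under eq_Rintegral do rewrite big_cons.
by rewrite intD ?IH ?big_cons//; exact: bmf_sum.
Qed.

Lemma int_ge_lb f c : bmf f -> (forall x, B x -> c <= f x) ->
  c <= \int[P]_x f x.
Proof. by move=> bf fc; rewrite -(int_cst c); apply: le_int => //; exact: bmf_cst. Qed.

Lemma norm_int_le f g : bmf f -> bmf g -> (forall x, B x -> `|f x| <= g x) ->
  `|\int[P]_x f x| <= \int[P]_x g x.
Proof.
move=> bf bg fg; rewrite ler_norml; apply/andP; split.
  rewrite -[X in X <= _]mulN1r -intZl//; apply: le_int => //.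
    by apply: bmfM => //; exact: bmf_cst.
  by move=> x Bx; rewrite mulN1r; have := fg _ Bx; rewrite ler_norml => /andP[].
by apply: le_int => // x Bx; rewrite (le_trans (ler_norm _))// fg.
Qed.

End bounded_on_full_set.
Arguments bmf {d T R} B f.

(** * Exponentially tilted moments of the base measure *)

Section tilted_moments.
Context (R : realType) (km kp : R) (mu : probability (measurableTypeR R) R).
Hypothesis muB : mu `[km, kp]%classic = 1%E.

(** The added 1 makes the bound at least 1, so its powers increase and constants with different
    exponents can be compared. *)
Definition supp_bound : R := Num.max `|km| `|kp| + 1.

Lemma supp_bound_ge1 : 1 <= supp_bound.
Proof. by rewrite /supp_bound lerDr le_max normr_ge0. Qed.

Lemma supp_bound_gt0 : 0 < supp_bound.
Proof. exact: lt_le_trans ltr01 supp_bound_ge1. Qed.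

Lemma norm_le_supp_bound z : km <= z <= kp -> `|z| <= supp_bound.
Proof.
move=> /andP[kz zk]; rewrite /supp_bound ler_norml.
have h1 : `|km| <= Num.max `|km| `|kp| by rewrite le_max lexx.
have h2 : `|kp| <= Num.max `|km| `|kp| by rewrite le_max lexx orbT.
have h3 := ler_norm kp; have h4 := ler_norm (- km); rewrite normrN in h4.
by apply/andP; split; lra.
Qed.

Let B : set (measurableTypeR R) := `[km, kp]%classic.
Let mB : measurable B. Proof. exact: measurable_itv. Qed.
Local Notation K := supp_bound.

Lemma supp_norm (z : measurableTypeR R) : B z -> `|z| <= K.
Proof. by rewrite /B /= in_itv; exact: norm_le_supp_bound. Qed.

Lemma bmf_id : bmf B (fun z => z : R).
Proof. by split; [exact: measurable_id|exists K; exact: supp_norm]. Qed.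

Lemma bmf_tilt (p : nat) (t : R) : bmf B (fun z => z ^+ p * expR (t * z)).
Proof.
apply: bmfM; first exact/bmfX/bmf_id.
apply: bmf_expR; apply: bmfM; [exact: bmf_cst|exact: bmf_id].
Qed.

Definition mom (p : nat) (t : R) : R := \int[mu]_z (z ^+ p * expR (t * z)).

Lemma mom0_bounds t : expR (- (K * `|t|)) <= mom 0 t <= expR (K * `|t|).
Proof.
have bd z : B z -> `|t * z| <= K * `|t|.
  by move=> Bz; rewrite normrM mulrC ler_wpM2r// supp_norm.
apply/andP; split.
  apply: (int_ge_lb mB muB); first exact: bmf_tilt.
  move=> z /bd; rewrite ler_norml => /andP[h _].
  by rewrite expr0 mul1r ler_expR.
rewrite -[leRHS](int_cst mu); apply: (le_int mB muB).
- exact: bmf_tilt.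
- exact: bmf_cst.
move=> z /bd; rewrite ler_norml => /andP[_ h].
by rewrite expr0 mul1r ler_expR.
Qed.

Lemma mom0_gt0 t : 0 < mom 0 t.
Proof. by have /andP[+ _] := mom0_bounds t; apply: lt_le_trans; exact: expR_gt0. Qed.

Lemma norm_mom p t : `|mom p t| <= K ^+ p * mom 0 t.
Proof.
rewrite /mom -(intZl mB muB _ (bmf_tilt 0 t)).
apply: (norm_int_le mB muB); first exact: bmf_tilt.
  by apply: bmfM; [exact: bmf_cst|exact: bmf_tilt].
move=> z Bz; rewrite expr0 mul1r normrM (ger0_norm (expR_ge0 _)).
rewrite ler_wpM2r ?expR_ge0// normrX lerXn2r ?nnegrE// ?supp_norm//.
exact: ltW supp_bound_gt0.
Qed.

Lemma is_derive_mom p (t : R) : is_derive t 1 (mom p) (mom p.+1 t).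
Proof.
pose f (t : R) (z : measurableTypeR R) : R := z ^+ p * expR (t * z).
have df (s : R) (z : R) : is_derive s 1 (f ^~ z) (z ^+ p.+1 * expR (s * z)).
  have -> : f ^~ z = z ^+ p \*: (expR \o (z \*: id)).
    by apply/funext => r; rewrite /f /= /GRing.scale /= (mulrC r).
  have h := @is_deriveZ R R R id z s 1 _ (is_derive_id s 1).
  have h2 := @is_derive1_comp R expR (z \*: id) s _ _ (is_derive_expR _) h.
  have h3 := @is_deriveZ R R R _ (z ^+ p) s 1 _ h2.
  apply: (is_derive_eq h3).
  by rewrite /GRing.scale /= exprSr (mulrC s); ring.
have momE q s : mom q s = \int[mu]_(z in B) (z ^+ q * expR (s * z)).
  by rewrite /mom (Rintegral_full mB muB)//; exact: bmf_tilt.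
have It : `]t - 1, t + 1[%classic t by rewrite /= in_itv /=; apply/andP; split; lra.
have d1 s z : partial1of2 f s z = z ^+ p.+1 * expR (s * z).
  by rewrite partial1of2E; apply: derive_val.
(* A constant majorant of the derivative of the integrand, valid for all parameters within distance
   1 of [t]. *)
pose G (z : measurableTypeR R) : R := K ^+ p.+1 * expR ((`|t| + 1) * K).
have intf s : `]t - 1, t + 1[%classic s -> mu.-integrable B (EFin \o f s).
  by move=> _; apply: (integrable_full mB muB); exact: bmf_tilt.
have derf s z : `]t - 1, t + 1[%classic s -> B z -> derivable (f ^~ z) s 1.
  by move=> _ _; apply: (@ex_derive _ _ _ _ _ _ _ (df s z)).
have G0 z : 0 <= G z.
  by rewrite mulr_ge0 ?expR_ge0 ?exprn_ge0// ltW ?supp_bound_gt0.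
have iG : mu.-integrable B (EFin \o G).
  by apply: (integrable_full mB muB); exact: bmf_cst.
have Gub s z : `]t - 1, t + 1[%classic s -> B z -> `|partial1of2 f s z| <= G z.
  rewrite /= in_itv /= => /andP[h1 h2] Bz.
  rewrite d1 normrM ler_pM// ?normrX.
    by rewrite lerXn2r ?nnegrE// ?supp_norm// ltW ?supp_bound_gt0.
  rewrite (ger0_norm (expR_ge0 _)) ler_expR (le_trans (ler_norm _))// normrM.
  rewrite ler_pM ?supp_norm// (_ : s = t + (s - t)); last by ring.
  by rewrite (le_trans (ler_normD _ _))// lerD2l ler_norml; apply/andP; split; lra.
have momF : mom p = fun s => \int[mu]_(z in B) f s z by apply/funext => s; exact: momE.
have dv : derivable (mom p) t 1.
  rewrite momF; exact: (derivable_under_integral mB It intf derf G0 iG Gub).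
apply: DeriveDef => //; rewrite -derive1E momF.
rewrite (differentiation_under_integral mB It intf derf G0 iG Gub).
rewrite momE; apply: eq_Rintegral => z _.
exact: d1.
Qed.

(** Moments of [mu] tilted by e^(t z): [psi 1] is the derivative of [Lambda], and
    [psi 2 t - psi 1 t ^+ 2] is the tilted variance. *)
Definition psi (p : nat) (t : R) : R := mom p t / mom 0 t.

Lemma norm_psi p t : `|psi p t| <= K ^+ p.
Proof.
rewrite /psi normrM normfV (ger0_norm (ltW (mom0_gt0 t))).
by rewrite ler_pdivrMr ?mom0_gt0// norm_mom.
Qed.

Lemma is_derive_psi p (t : R) :
  is_derive t 1 (psi p) (psi p.+1 t - psi p t * psi 1 t).
Proof.
have n0 : mom 0 t != 0 by rewrite gt_eqF// mom0_gt0.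
have dV := is_deriveV n0 (is_derive_mom 0 t).
apply: (is_derive_eq (is_deriveM (is_derive_mom p t) dV)).
rewrite /psi /GRing.scale /=; field.
exact: n0.
Qed.

Lemma is_derive_Lambda (t : R) : is_derive t 1 (Lambda mu) (psi 1 t).
Proof.
have -> : Lambda mu = @ln R \o mom 0.
  apply/funext => s; rewrite /Lambda /mom; congr ln.
  by apply: eq_Rintegral => z _; rewrite expr0 mul1r.
have h := is_derive1_comp (is_derive1_ln (mom0_gt0 t)) (is_derive_mom 0 t).
by apply: (is_derive_eq h); rewrite /psi mulrC.
Qed.

Lemma derive1_Lambda (t : R) : derive1 (Lambda mu) t = psi 1 t.
Proof. by rewrite derive1E; exact: (@derive_val _ _ _ _ _ _ _ (is_derive_Lambda t)). Qed.

End tilted_moments.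

(** * Lipschitz bounds, variance lower bounds and convexity *)

Section tilted_regularity.
Context (R : realType) (km kp : R) (mu : probability (measurableTypeR R) R).
Hypotheses (ltk : km < kp) (muB : mu `[km, kp]%classic = 1%E).
Local Notation K := (supp_bound km kp).
Local Notation psi := (psi mu).
Local Notation mom := (mom mu).

Lemma MVT_any (f df : R -> R) (a b : R) :
  (forall x, is_derive x (1 : R) f (df x)) ->
  exists c, [/\ Num.min a b <= c, c <= Num.max a b & f b - f a = df c * (b - a)].
Proof.
move=> dff.
have cf (S : set R) : {within S, continuous f}.
  apply: continuous_subspaceT => x.
  exact/differentiable_continuous/derivable1_diffP/(@ex_derive _ _ _ _ _ _ _ (dff x)).
have [ab|/ltW ab] := leP a b.
  have [c] := MVT_segment ab (fun x _ => dff x) (cf _).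
  by rewrite in_itv /= => /andP[h1 h2] h3; exists c; split.
have [c] := MVT_segment ab (fun x _ => dff x) (cf _).
rewrite in_itv /= => /andP[h1 h2] h3; exists c; split => //.
by rewrite -opprB h3; ring.
Qed.

(** Each of the two terms of the derivative of [psi p] is at most [K ^+ p.+1] in absolute value on
    the whole line. *)
Lemma psi_lip p (a b : R) : `|psi p b - psi p a| <= 2 * K ^+ p.+1 * `|b - a|.
Proof.
have [c [_ _ ->]] := MVT_any a b (is_derive_psi muB p).
rewrite normrM ler_wpM2r//.
apply: (le_trans (ler_normB _ _)).
have h1 := norm_psi muB p.+1 c.
rewrite (normrM (psi p c)); have h2 := norm_psi muB p c; have h3 := norm_psi muB 1 c.
have : `|psi p c| * `|psi 1 c| <= K ^+ p * K ^+ 1 by rewrite ler_pM.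
rewrite -exprD addn1 => h4.
by rewrite mulr_natl mulr2n lerD.
Qed.

Hypotheses (skm : measure_supp mu km) (skp : measure_supp mu kp).

Let B : set (measurableTypeR R) := `[km, kp]%classic.
Let mB : measurable B. Proof. exact: measurable_itv. Qed.

Lemma bmf_sqdev (c : R) : bmf B (fun z => (z - c) ^+ 2).
Proof. by apply/bmfX/bmfB; [exact: bmf_id|exact: bmf_cst]. Qed.

(** Every point of the ball of radius (kp - km)/4 about [s] is at distance at least (kp - km)/4 from
    [c]; the ball has positive mass because [s] is in the support. *)
Lemma sqdev_ge (s c : R) : measure_supp mu s -> (kp - km) / 2 <= `|c - s| ->
  ((kp - km) / 4) ^+ 2 * fine (mu (ball s ((kp - km) / 4))) <=
  \int[mu]_z (z - c) ^+ 2.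
Proof.
move=> ss cs; set d := (kp - km) / 4; set U : set (measurableTypeR R) := ball s d.
have mU : measurable U by exact: measurable_ball.
rewrite -(setIT U) -(integral_indic mu measurableT mU).
rewrite -[fine _]/(\int[mu]_z (\1_U z)) -(intZl mB muB); last exact: bmf_indic.
apply: (le_int mB muB).
- by apply: bmfM; [exact: bmf_cst|exact: bmf_indic].
- exact: bmf_sqdev.
move=> z _; rewrite indicE; case: (boolP (z \in U)) => zU; last first.
  by rewrite mulr0 sqr_ge0.
rewrite mulr1; move/set_mem : zU; rewrite /U /ball /= => zU.
rewrite -[leRHS]real_normK ?num_real//.
have d0 : 0 <= d by rewrite /d divr_ge0// subr_ge0 ltW.
rewrite lerXn2r ?nnegrE//.
have := ler_normD (c - z) (z - s); rewrite (_ : c - z + (z - s) = c - s); last by ring.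
rewrite (distrC c z) => h1; rewrite distrC in zU.
 by rewrite /d in zU *; lra.
Qed.

(** Any [c] is at distance at least (kp - km)/2 from one of the endpoints, and both lie in the
    support. The bound is uniform in the centre, so it applies to the tilted mean whatever its
    value. *)
Lemma sqdev_lb : exists2 V : R, 0 < V & forall c, V <= \int[mu]_z (z - c) ^+ 2.
Proof.
have d0 : 0 < (kp - km) / 4 by rewrite divr_gt0// subr_gt0.
have pos s : measure_supp mu s ->
    0 < ((kp - km) / 4) ^+ 2 * fine (mu (ball s ((kp - km) / 4))).
  move=> ss; rewrite mulr_gt0 ?exprn_gt0// fine_gt0//; apply/andP; split.
    by apply: ss; [exact: ball_open|exact: ballxx].
  by rewrite (le_lt_trans (probability_le1 _ _))// ?ltry//; exact: measurable_ball.
exists (Num.min (((kp - km) / 4) ^+ 2 * fine (mu (ball km ((kp - km) / 4))))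
                (((kp - km) / 4) ^+ 2 * fine (mu (ball kp ((kp - km) / 4))))).
  by rewrite lt_min !pos.
move=> c; rewrite ge_min.
have [h|h] := leP ((kp - km) / 2) `|c - km|.
  by rewrite sqdev_ge.
rewrite orbC sqdev_ge//.
have := ler_normD (kp - c) (c - km); rewrite (_ : kp - c + (c - km) = kp - km); last by ring.
by rewrite (ger0_norm (_ : 0 <= kp - km)) ?subr_ge0 ?(ltW ltk)// (distrC kp); lra.
Qed.

Lemma var_psi (t : R) :
  (psi 2 t - psi 1 t ^+ 2) * mom 0 t =
  \int[mu]_z ((z - psi 1 t) ^+ 2 * expR (t * z)).
Proof.
set c := psi 1 t.
have bt (p : nat) : bmf B (fun z => z ^+ p * expR (t * z)) by exact: bmf_tilt.
have bc (e : R) (p : nat) : bmf B (fun z => e * (z ^+ p * expR (t * z))).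
  by apply: bmfM; [exact: bmf_cst|exact: bt].
rewrite (_ : \int[mu]_z _ = \int[mu]_z (z ^+ 2 * expR (t * z)
   - 2 * c * (z ^+ 1 * expR (t * z)) + c ^+ 2 * (z ^+ 0 * expR (t * z)))); last first.
  have E (y u e : R) : (y - u) ^+ 2 * e =
      y ^+ 2 * e - 2 * u * (y ^+ 1 * e) + u ^+ 2 * (y ^+ 0 * e).
    by rewrite expr0 expr1; ring.
  by apply: eq_Rintegral => z _; exact: E.
rewrite (intD mB muB (bmfB (bt 2) (bc _ 1)) (bc _ 0)) (intB mB muB (bt 2) (bc _ 1)).
rewrite (intZl mB muB _ (bt 1)) (intZl mB muB _ (bt 0)) -!/(mom _ _).
have n0 : mom 0 t != 0 by rewrite gt_eqF// (mom0_gt0 muB).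
have -> : mom 1 t = c * mom 0 t by rewrite /c /psi divfK.
have -> : mom 2 t = psi 2 t * mom 0 t by rewrite /psi divfK.
by ring.
Qed.

(** For |t| <= Th the tilting factor is at least exp(-K Th) on the support interval and the
    normalisation is at most exp(K Th); together they cost exp(-2 K Th) compared with the untilted
    bound. *)
Lemma var_psi_lb (Th : R) : exists2 v : R, 0 < v &
  forall t, `|t| <= Th -> v <= psi 2 t - psi 1 t ^+ 2.
Proof.
have [V V0 VP] := sqdev_lb.
exists (V * expR (- (2 * K * Th))); first by rewrite mulr_gt0 ?expR_gt0.
move=> t tTh; rewrite -(ler_pM2r (mom0_gt0 muB t)) var_psi.
have K0 := supp_bound_gt0 km kp.
have /andP[_ m0] := mom0_bounds muB t.
apply: (@le_trans _ _ (expR (- (K * Th)) * \int[mu]_z (z - psi 1 t) ^+ 2)).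
  rewrite (_ : - (2 * K * Th) = - (K * Th) + - (K * Th)); last by ring.
  rewrite expRD mulrA [X in X * _]mulrC -!mulrA ler_pM2l ?expR_gt0//.
  apply: le_trans (VP (psi 1 t)); rewrite -[leRHS]mulr1 ler_pM2l//.
  rewrite -(ler_pM2l (expR_gt0 (K * Th))) mulrA -expRD subrr expR0 mul1r mulr1.
  by rewrite (le_trans m0)// ler_expR ler_pM2l.
rewrite -(intZl mB muB); last exact: bmf_sqdev.
apply: (le_int mB muB).
- by apply: bmfM; [exact: bmf_cst|exact: bmf_sqdev].
- apply: bmfM; first exact: bmf_sqdev.
  by apply: bmf_expR; apply: bmfM; [exact: bmf_cst|exact: bmf_id].
move=> z Bz; rewrite mulrC ler_wpM2l ?sqr_ge0// ler_expR.
have : `|t * z| <= K * Th by rewrite normrM mulrC ler_pM// supp_norm.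
by rewrite ler_norml => /andP[].
Qed.

Lemma psi1_mono (Th v : R) (a b : R) :
  (forall t, `|t| <= Th -> v <= psi 2 t - psi 1 t ^+ 2) ->
  `|a| <= Th -> `|b| <= Th ->
  v * (b - a) ^+ 2 <= (psi 1 b - psi 1 a) * (b - a).
Proof.
move=> hv aT bT; have [c [h1 h2 ->]] := MVT_any a b (is_derive_psi muB 1).
rewrite -mulrA -expr2 ler_wpM2r ?sqr_ge0//.
apply: hv.
move: aT bT; rewrite !ler_norml => /andP[? ?] /andP[? ?].
by apply/andP; split; [apply: le_trans h1; rewrite le_min; apply/andP|
  apply: (le_trans h2); rewrite ge_max; apply/andP].
Qed.

Lemma psi1_mono_ge0 (a b : R) : 0 <= (psi 1 b - psi 1 a) * (b - a).
Proof.
have [v v0 hv] := var_psi_lb (Num.max `|a| `|b|).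
apply: le_trans (psi1_mono hv _ _); rewrite ?le_max ?lexx ?orbT//.
by rewrite mulr_ge0 ?sqr_ge0// ltW.
Qed.

Lemma psi1_mono_eq (a b : R) : (psi 1 b - psi 1 a) * (b - a) <= 0 -> a = b.
Proof.
have [v v0 hv] := var_psi_lb (Num.max `|a| `|b|).
move=> h; have : v * (b - a) ^+ 2 <= 0.
  by apply: le_trans h; apply: (psi1_mono hv); rewrite le_max lexx ?orbT.
rewrite pmulr_rle0// => h2; apply/esym/eqP; rewrite -subr_eq0 -sqrf_eq0.
by rewrite eq_le h2 sqr_ge0.
Qed.

Lemma Lambda_convex (a b : R) : Lambda mu b - Lambda mu a <= psi 1 b * (b - a).
Proof.
have [c [h1 h2 ->]] := MVT_any a b (is_derive_Lambda muB).
have := psi1_mono_ge0 c b.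
have [ab|ba] := leP a b.
  rewrite (max_idPr ab) in h2.
  have [->|nbc] := eqVneq c b; first by [].
  rewrite pmulr_lge0 ?subr_ge0; last by rewrite subr_gt0 lt_neqAle nbc.
  by move=> h; rewrite ler_wpM2r ?subr_ge0.
rewrite (min_idPr (ltW ba)) in h1.
have [->|nbc] := eqVneq c b; first by [].
rewrite nmulr_lge0 ?subr_le0; last by rewrite subr_lt0 lt_neqAle eq_sym nbc.
by move=> h; rewrite ler_wnM2r ?subr_le0 ?(ltW ba).
Qed.

End tilted_regularity.

(** * Resampling one coordinate under a product measure *)

Definition upd (T : Type) n (i : 'I_n) (z : T) (x : n.-tuple T) : n.-tuple T :=
  [tuple if j == i then z else tnth x j | j < n].

Lemma tnth_upd (T : Type) n (i j : 'I_n) (z : T) (x : n.-tuple T) :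
  tnth (upd i z x) j = if j == i then z else tnth x j.
Proof. by rewrite tnth_mktuple. Qed.

Section resampling.
Context d (T : measurableType d) (R : realType).

Lemma upd_cons0 n z w (t : n.-tuple T) :
  upd ord0 w (tuple_cons (z, t)) = tuple_cons (w, t).
Proof.
apply: eq_from_tnth => j; rewrite tnth_upd.
by case: (unliftP ord0 j) => [k ->|->]; rewrite ?(tnthS, eqxx) ?tnth0.
Qed.

Lemma upd_consS n (j : 'I_n) z w (t : n.-tuple T) :
  upd (lift ord0 j) w (tuple_cons (z, t)) = tuple_cons (z, upd j w t).
Proof.
apply: eq_from_tnth => k; rewrite tnth_upd.
case: (unliftP ord0 k) => [l ->|->]; last by rewrite ?tnth0.
by rewrite !tnthS tnth_upd (inj_eq lift_inj).
Qed.

Lemma measurable_upd n (i : 'I_n) :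
  measurable_fun setT (fun xz : n.-tuple T * T => upd i xz.2 xz.1).
Proof.
apply/measurable_fun_tnthP => j.
rewrite (_ : _ \o _ = fun xz : n.-tuple T * T => if j == i then xz.2 else tnth xz.1 j); last first.
  by apply/funext => -[x z] /=; rewrite tnth_upd.
case: eqP => _; first exact: measurable_snd.
by apply: (measurableT_comp (measurable_tnth j)); exact: measurable_fst.
Qed.

Variable mu : probability T R.
Local Open Scope ereal_scope.

Lemma integral_prob_powerS n (F : n.+1.-tuple T -> \bar R) :
  measurable_fun setT F -> (forall x, 0 <= F x) ->
  \int[prob_power mu n.+1]_x F x =
  \int[mu]_z \int[prob_power mu n]_t F (tuple_cons (z, t)).
Proof.
move=> mF F0 /=.
rewrite ge0_integral_pushforward//=.
rewrite /product_prob preimage_setT.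
rewrite (fubini_tonelli1 (F \o @tuple_cons d T n))//.
  by apply: measurableT_comp.
by move=> x; exact: F0.
Qed.

Lemma measurable_resample n (i : 'I_n) (F : n.-tuple T -> \bar R) :
  measurable_fun setT F -> (forall x, 0 <= F x) ->
  measurable_fun setT (fun x => \int[mu]_z F (upd i z x)).
Proof.
move=> mF F0.
apply: (@measurable_fun_fubini_tonelli_F _ _ _ _ _ mu (fun xz => F (upd i xz.2 xz.1))) => //.
by apply: (measurableT_comp mF); exact: measurable_upd.
Qed.

(** Induction reduces the claim to the first coordinate. There the updated integrand no longer
    depends on the old value, whose integral has total mass 1, and Tonelli exchanges the two
    remaining integrals. *)
Lemma integral_resample n (i : 'I_n) (F : n.-tuple T -> \bar R) :
  measurable_fun setT F -> (forall x, 0 <= F x) ->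
  \int[prob_power mu n]_x F x =
  \int[prob_power mu n]_x \int[mu]_z F (upd i z x).
Proof.
elim: n i F => [[]//|n IH] i F mF F0.
have mcons (z : T) : measurable_fun setT (fun t : n.-tuple T => F (tuple_cons (z, t))).
  apply: (measurableT_comp mF).
  by apply: (@measurable_cons _ _ _ _ (fun=> z) n id).
rewrite integral_prob_powerS// integral_prob_powerS; last 2 first.
  exact: measurable_resample.
  by move=> x; exact: integral_ge0.
case: (unliftP ord0 i) => [j ->|->].
  apply: eq_integral => z _; rewrite (IH j)//.
  by apply: eq_integral => t _; apply: eq_integral => w _; rewrite upd_consS.
under [RHS]eq_integral do under eq_integral do
  under eq_integral do rewrite upd_cons0.
rewrite integral_cst// [X in _ * X]probability_setT mule1.
rewrite (fubini_tonelli (F \o @tuple_cons d T n))//.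
  by apply: measurableT_comp.
by move=> x; exact: F0.
Qed.

Lemma prob_power_full n (B : set T) : measurable B -> mu B = 1 ->
  measurable [set x : n.-tuple T | forall i, B (tnth x i)] /\
  prob_power mu n [set x : n.-tuple T | forall i, B (tnth x i)] = 1.
Proof.
move=> mB muB; split; last by rewrite (prob_power_box mu (fun=> mB)) big1.
rewrite (_ : [set _ | _] =
  \bigcap_(i in [set: 'I_n]) ((@tnth n T)^~ i @^-1` B)).
  apply: fin_bigcap_measurable; first exact: finite_finset.
  by move=> i _; rewrite -[X in measurable X]setTI; exact: measurable_tnth.
by apply/seteqP; split=> [x Bx i _|x Bx i]; [exact: Bx|exact: (Bx i I)].
Qed.

(** A tower property without conditional expectations. On each fibre the positive and negative parts
    have the same finite integral, so the resampling identity is applied to nonnegative functions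
    only. *)
Lemma int_resample0 n (i : 'I_n) (F : n.-tuple T -> R) :
  (prob_power mu n).-integrable setT (EFin \o F) ->
  (forall x, mu.-integrable setT (fun z => (F (upd i z x))%:E)) ->
  (forall x, \int[mu]_z F (upd i z x) = 0)%R ->
  (\int[prob_power mu n]_x F x = 0)%R.
Proof.
move=> iF iG G0; rewrite /Rintegral integralE.
have mF := measurable_int _ iF.
rewrite (integral_resample i (measurable_funepos mF))//.
rewrite (integral_resample i (measurable_funeneg mF))//.
rewrite (_ : \int[prob_power mu n]_x \int[mu]_z (EFin \o F)^\+ (upd i z x) =
  \int[prob_power mu n]_x \int[mu]_z (EFin \o F)^\- (upd i z x)); last first.
  apply: eq_integral => x _.
  pose G z := upd i z x.
  have iGx : mu.-integrable setT ((EFin \o F) \o G) by exact: iG.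
  have h : \int[mu]_z ((EFin \o F) \o G) z = 0.
    rewrite -[LHS]fineK; last exact: integrable_fin_num.
    by congr (_%:E); exact: G0.
  have h1 := integrable_pos_fin_num measurableT iGx.
  have h2 := integrable_neg_fin_num measurableT iGx.
  move: h; rewrite integralE => /eqP.
  rewrite sube_eq ?fin_num_adde_defl// add0e funepos_comp funeneg_comp.
  by move/eqP.
rewrite subee//.
rewrite -(integral_resample i (measurable_funeneg mF))//.
exact: (integrable_neg_fin_num measurableT iF).
Qed.

End resampling.

(** * The Hamiltonian and the local fields as functions of one coordinate *)

Section quadratic_forms.
Context (R : realType) (N : nat).
Local Notation I := 'I_N.
Implicit Types (x : N.-tuple R) (l : I).

Lemma sum_delta (l : I) (F : I -> R) : \sum_j (j == l)%:R * F j = F l.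
Proof.
rewrite (bigD1 l)//= eqxx mul1r big1 ?addr0// => j /negbTE ->.
by rewrite mul0r.
Qed.

Lemma tnth_upd_delta l z x j :
  tnth (upd l z x) j = tnth (upd l 0 x) j + z * (j == l)%:R.
Proof. by rewrite !tnth_upd; case: eqP => _; rewrite ?(mulr1, mulr0, addr0, add0r). Qed.

Lemma linear_upd (M : I -> R) l z x :
  \sum_j M j * tnth (upd l z x) j = \sum_j M j * tnth (upd l 0 x) j + z * M l.
Proof.
rewrite -(sum_delta l M) mulr_sumr -big_split /=; apply: eq_bigr => j _.
by rewrite tnth_upd_delta; ring.
Qed.

Lemma linear_upd0 (M : I -> R) l z x : M l = 0 ->
  \sum_j M j * tnth (upd l z x) j = \sum_j M j * tnth x j.
Proof.
move=> M0; apply: eq_bigr => j _; rewrite tnth_upd; case: eqP => // ->.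
by rewrite M0 !mul0r.
Qed.

Definition qform (B : I -> I -> R) x : R := \sum_j \sum_k B j k * tnth x j * tnth x k.

Lemma qformE (B : I -> I -> R) x :
  qform B x = \sum_j (\sum_k B j k * tnth x k) * tnth x j.
Proof.
apply: eq_bigr => j _; rewrite mulr_suml; apply: eq_bigr => k _.
by ring.
Qed.

(** A zero diagonal entry at [l] excludes the square of x_l, so the form is affine in x_l, with
    slope collected from row [l] and column [l]. *)
Lemma qform_upd (B : I -> I -> R) l z x : B l l = 0 ->
  qform B (upd l z x) =
  qform B (upd l 0 x) + z * \sum_k (B l k + B k l) * tnth x k.
Proof.
move=> Bll.
rewrite !qformE.
under eq_bigr do rewrite linear_upd.
under eq_bigr do rewrite tnth_upd_delta.
rewrite (eq_bigr (fun j => (\sum_k B j k * tnth (upd l 0 x) k) * tnth (upd l 0 x) j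
  + z * ((j == l)%:R * (\sum_k B j k * tnth (upd l 0 x) k))
  + z * (B j l * tnth (upd l 0 x) j) + z ^+ 2 * ((j == l)%:R * B j l))); last first.
  by move=> j _; ring.
rewrite !big_split /= -!mulr_sumr !sum_delta Bll mulr0 addr0 -addrA -mulrDr.
congr (_ + _ * _); rewrite !linear_upd0//.
by rewrite -big_split /=; apply: eq_bigr => j _; rewrite mulrDl.
Qed.

Lemma qform_upd0 (B : I -> I -> R) l z x :
  (forall k, B l k = 0) -> (forall k, B k l = 0) ->
  qform B (upd l z x) = qform B x.
Proof.
move=> B1 B2; apply: eq_bigr => j _; apply: eq_bigr => k _.
rewrite !tnth_upd; case: eqP => [->|_]; first by rewrite B1 !mul0r.
by case: eqP => [->|_]; first by rewrite B2 !mul0r.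
Qed.

Lemma upd_id l x : upd l (tnth x l) x = x.
Proof. by apply: eq_from_tnth => j; rewrite tnth_upd; case: eqP => [->|]. Qed.

Lemma upd_upd l z w x : upd l z (upd l w x) = upd l z x.
Proof. by apply: eq_from_tnth => j; rewrite !tnth_upd; case: eqP. Qed.

Variables (A : I -> I -> I -> R) (cA : coupling_tensor A).

Lemma coupling_sym12 i j k : A i j k = A j i k. Proof. by case: cA. Qed.
Lemma coupling_sym23 i j k : A i j k = A i k j. Proof. by case: cA. Qed.
Lemma coupling_sym13 i j k : A i j k = A k j i.
Proof. by rewrite coupling_sym12 coupling_sym23 coupling_sym12. Qed.
Lemma coupling_ge0 i j k : 0 <= A i j k. Proof. by case: cA. Qed.
Lemma coupling_diag12 i k : A i i k = 0.
Proof. by case: cA => _ _ _ -> //; rewrite eqxx. Qed.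
Lemma coupling_diag23 i k : A i k k = 0.
Proof. by rewrite coupling_sym13 coupling_diag12. Qed.
Lemma coupling_diag13 i k : A i k i = 0.
Proof. by rewrite coupling_sym23 coupling_diag12. Qed.

Lemma local_field_upd l z x : local_field A (upd l z x) l = local_field A x l.
Proof.
by apply: (qform_upd0 (B := A l)) => k; [exact: coupling_diag12|exact: coupling_diag13].
Qed.

Lemma local_field_upd_ne l z x i :
  local_field A (upd l z x) i =
  local_field A (upd l 0 x) i + z * (2 * \sum_k A i l k * tnth x k).
Proof.
rewrite [LHS](qform_upd (B := A i)) ?coupling_diag23//; congr (_ + _ * _).
rewrite mulr_sumr; apply: eq_bigr => k _.
by rewrite (coupling_sym23 i k l); ring.
Qed.

(** As [A] vanishes on repeated indices, the cubic form is affine in each coordinate. The index [l]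
    can stand in three positions, which cancels the 3 in [b / 3]; the slope is the tilt of the
    conditional law of x_l. *)
Lemma hamiltonian_upd b h l z x :
  hamiltonian A b h (upd l z x) =
  (b * local_field A x l + h) * z + hamiltonian A b h (upd l 0 x).
Proof.
rewrite /hamiltonian.
have cubeE y : \sum_i \sum_j \sum_k A i j k * tnth y i * tnth y j * tnth y k =
    \sum_i tnth y i * local_field A y i.
  apply: eq_bigr => i _; rewrite mulr_sumr; apply: eq_bigr => j _.
  by rewrite mulr_sumr; apply: eq_bigr => k _; ring.
have sumE y : \sum_i tnth y i = \sum_i 1 * tnth y i.
  by apply: eq_bigr => i _; rewrite mul1r.
rewrite !cubeE !sumE linear_upd mulr1.
suff -> : \sum_i tnth (upd l z x) i * local_field A (upd l z x) i =
    \sum_i tnth (upd l 0 x) i * local_field A (upd l 0 x) i + 3 * z * local_field A x l.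
  by field.
pose c i := \sum_k A i l k * tnth x k.
under eq_bigr do rewrite local_field_upd_ne tnth_upd_delta.
(* One copy of [z * local_field A x l] comes from the factor x_l and two from the fields of the
   other sites; the [z ^+ 2] term vanishes because [c l = 0]. *)
rewrite (eq_bigr (fun i => tnth (upd l 0 x) i * local_field A (upd l 0 x) i
  + z * ((i == l)%:R * local_field A (upd l 0 x) i)
  + 2 * z * (c i * tnth (upd l 0 x) i) + 2 * z ^+ 2 * ((i == l)%:R * c i))); last first.
  by move=> j _; rewrite -/(c j); ring.
have cl : c l = 0 by rewrite /c big1// => k _; rewrite coupling_diag12 mul0r.
rewrite !big_split /= -!mulr_sumr !sum_delta cl mulr0 addr0 linear_upd0//.
rewrite local_field_upd.
have -> : \sum_i c i * tnth x i = local_field A x l.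
  rewrite [RHS](qformE (A l)); apply: eq_bigr => i _; congr (_ * _).
  by apply: eq_bigr => k _; rewrite coupling_sym12.
by ring.
Qed.

End quadratic_forms.

(** * Expectations under the Gibbs measure *)

Section gibbs_expectation.
Context (R : realType) (km kp : R) (mu : probability (measurableTypeR R) R).
Hypotheses (lek : km <= kp) (muB : mu `[km, kp]%classic = 1%E).
Variables (N : nat) (A : 'I_N -> 'I_N -> 'I_N -> R) (b h : R).
Hypothesis cA : coupling_tensor A.
Local Notation K := (supp_bound km kp).
Local Notation psi := (psi mu).
Local Notation mom := (mom mu).
Local Notation tT := (N.-tuple (measurableTypeR R)).
Local Notation PN := (prob_power mu N).
Local Notation m := (local_field A).

Definition box : set tT := [set x | forall i, `[km, kp]%classic (tnth x i)].

Let mB : measurable (`[km, kp]%classic : set (measurableTypeR R)).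
Proof. exact: measurable_itv. Qed.

Lemma measurable_box : measurable box.
Proof. by have [] := prob_power_full N mB muB. Qed.

Lemma box_full : PN box = 1%E.
Proof. by have [] := prob_power_full N mB muB. Qed.

Local Notation mbox := measurable_box.
Local Notation fbox := box_full.

Lemma box_norm x i : box x -> `|tnth x i| <= K.
Proof. by move=> /(_ i); exact: supp_norm. Qed.

Lemma box_upd x i : box x -> box (upd i km x).
Proof.
move=> bx j; rewrite tnth_upd; case: eqP => // _.
by rewrite /= in_itv /= lexx lek.
Qed.

Lemma bmf_tnth i : bmf box (fun x => tnth x i : R).
Proof. by split; [exact: measurable_tnth|exists K => x /box_norm]. Qed.

Lemma bmf_local_field i : bmf box (fun x => m x i).
Proof.
apply: bmf_sum => j; apply: bmf_sum => k; apply: bmfM (bmf_tnth k).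
by apply: bmfM (bmf_tnth j); exact: bmf_cst.
Qed.

Lemma bmf_hamiltonian : bmf box (hamiltonian A b h).
Proof.
apply: bmfD; apply: bmfM; try exact: bmf_cst; last first.
  by apply: bmf_sum => i; exact: bmf_tnth.
apply: bmf_sum => i; apply: bmf_sum => j; apply: bmf_sum => k.
apply: bmfM (bmf_tnth k); apply: bmfM (bmf_tnth j).
by apply: bmfM (bmf_tnth i); exact: bmf_cst.
Qed.

Lemma measurable_psi p : measurable_fun setT (psi p).
Proof.
apply: continuous_measurable_fun => x.
apply/differentiable_continuous/derivable1_diffP.
exact: (@ex_derive _ _ _ _ _ _ _ (is_derive_psi muB p x)).
Qed.

Lemma bmf_psi p (f : tT -> R) : bmf box f -> bmf box (fun x => psi p (f x)).
Proof.
move=> [mf _]; split; first exact: (measurableT_comp (measurable_psi p) mf).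
by exists (K ^+ p) => x _; exact: norm_psi.
Qed.

Local Notation Z := (partition_fun mu A b h).

Lemma partition_gt0 : 0 < Z.
Proof.
have [_ [C HC]] := bmf_hamiltonian.
apply: (@lt_le_trans _ _ (expR (- C))); first exact: expR_gt0.
apply: (int_ge_lb mbox fbox); first exact/bmf_expR/bmf_hamiltonian.
by move=> x /HC; rewrite ler_expR ler_norml => /andP[].
Qed.

Definition weight (x : tT) : R := expR (hamiltonian A b h x) / Z.

Lemma bmf_weight : bmf box weight.
Proof. by apply: bmfM; [exact/bmf_expR/bmf_hamiltonian|exact: bmf_cst]. Qed.

Lemma weight_ge0 x : 0 <= weight x.
Proof. by rewrite mulr_ge0 ?expR_ge0// invr_ge0 ltW ?partition_gt0. Qed.

Definition gexp (F : tT -> R) : R := \int[PN]_x (F x * weight x).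

Let bw F : bmf box F -> bmf box (fun x => F x * weight x).
Proof. by move=> bF; apply: bmfM => //; exact: bmf_weight. Qed.

Lemma gexp_cst (c : R) : gexp (fun=> c) = c.
Proof.
rewrite /gexp (intZl mbox fbox); last exact: bmf_weight.
rewrite -[X in _ * X]/(\int[PN]_x (expR (hamiltonian A b h x) / Z)).
rewrite (_ : \int[PN]_x _ = \int[PN]_x (Z^-1 * expR (hamiltonian A b h x))); last first.
  by apply: eq_Rintegral => x _; rewrite mulrC.
rewrite (intZl mbox fbox); last exact/bmf_expR/bmf_hamiltonian.
by rewrite mulVf ?mulr1// gt_eqF// partition_gt0.
Qed.

Lemma le_gexp F G : bmf box F -> bmf box G -> (forall x, box x -> F x <= G x) ->
  gexp F <= gexp G.
Proof.
move=> bF bG FG; apply: (le_int mbox fbox); [exact: bw|exact: bw|].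
by move=> x bx; rewrite ler_wpM2r ?weight_ge0// FG.
Qed.

Lemma gexp_le F (c : R) : bmf box F -> (forall x, box x -> F x <= c) -> gexp F <= c.
Proof. by move=> bF Fc; rewrite -[leRHS]gexp_cst; apply: le_gexp => //; exact: bmf_cst. Qed.

Lemma gexpB F G : bmf box F -> bmf box G ->
  gexp (fun x => F x - G x) = gexp F - gexp G.
Proof.
move=> bF bG; rewrite /gexp -(intB mbox fbox (bw bF) (bw bG)).
by apply: eq_Rintegral => x _; rewrite mulrBl.
Qed.

Lemma gexpD F G : bmf box F -> bmf box G ->
  gexp (fun x => F x + G x) = gexp F + gexp G.
Proof.
move=> bF bG; rewrite /gexp -(intD mbox fbox (bw bF) (bw bG)).
by apply: eq_Rintegral => x _; rewrite mulrDl.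
Qed.

Lemma gexpZ (c : R) F : bmf box F -> gexp (fun x => c * F x) = c * gexp F.
Proof.
move=> bF; rewrite /gexp -(intZl mbox fbox _ (bw bF)).
by apply: eq_Rintegral => x _; rewrite mulrA.
Qed.

Lemma gexp_sum (J : Type) (r : seq J) (F : J -> tT -> R) :
  (forall j, bmf box (F j)) ->
  gexp (fun x => \sum_(j <- r) F j x) = \sum_(j <- r) gexp (F j).
Proof.
move=> bF; rewrite /gexp -(int_sum mbox fbox) => [|j]; last exact: bw.
by apply: eq_Rintegral => x _; rewrite mulr_suml.
Qed.

Lemma gibbs_measurable (E : set tT) : measurable E ->
  gibbs mu A b h E = (gexp (\1_E))%:E.
Proof.
move=> mE; rewrite /gibbs integral_mkcond /gexp /Rintegral fineK; last first.
  apply: integrable_fin_num => //.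
  by apply: (bmf_integrable mbox fbox); apply: bw; exact: bmf_indic.
apply: eq_integral => x _; rewrite patchE indicE /weight.
by case: ifP => xE; rewrite ?mul1r ?mul0r.
Qed.

(** The integral of a nonnegative function is a supremum over simple functions below it, so
    monotonicity holds for arbitrary sets. This gives lower bounds for events involving the MPLE,
    whose measurability is not established. *)
Lemma le_gibbs (E E' : set tT) : E `<=` E' ->
  (gibbs mu A b h E <= gibbs mu A b h E')%E.
Proof.
move=> EE'; rewrite /gibbs !ge0_integralE; last 2 first.
- by move=> x _; rewrite lee_fin weight_ge0.
- by move=> x _; rewrite lee_fin weight_ge0.
apply: ereal_sup_le => _ [f /= fE <-].
exists f => // x; apply: (le_trans (fE x)); rewrite !patchE.
case: ifPn => xE; case: ifPn => xE' //.
  by move: xE' => /negP[]; apply/mem_set/EE'/set_mem.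
by rewrite lee_fin weight_ge0.
Qed.

Lemma gibbs_le1 (E : set tT) : (gibbs mu A b h E <= 1)%E.
Proof.
apply: (@le_trans _ _ (gibbs mu A b h setT)); first exact: le_gibbs.
by rewrite gibbs_measurable// lee_fin indicT gexp_cst.
Qed.

Lemma gibbs_setC (E : set tT) : measurable E ->
  gibbs mu A b h (~` E) = (1 - gibbs mu A b h E)%E.
Proof.
move=> mE; rewrite !gibbs_measurable//; last exact: measurableC.
rewrite -EFinB -[X in (X - _)%:E]gexp_cst -gexpB; last 2 first.
- exact: bmf_cst.
- exact: bmf_indic.
congr (_%:E); congr gexp; apply/funext => x; rewrite !indicE in_setC.
by case: (x \in E); rewrite ?subr0 ?subrr.
Qed.

Lemma gibbs_le_gexp (E : set tT) (F : tT -> R) : measurable E -> bmf box F ->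
  (forall x, box x -> E x -> 1 <= F x) -> (forall x, box x -> 0 <= F x) ->
  (gibbs mu A b h E <= (gexp F)%:E)%E.
Proof.
move=> mE bF F1 F0; rewrite gibbs_measurable// lee_fin; apply: le_gexp => //.
  exact: bmf_indic.
move=> x bx; rewrite indicE; case: (boolP (x \in E)) => [/set_mem|_].
  exact: F1.
exact: F0.
Qed.

Definition resid (p : nat) (k : 'I_N) (x : tT) : R :=
  tnth x k ^+ p - psi p (b * m x k + h).

Lemma bmf_resid p k : bmf box (resid p k).
Proof.
apply: bmfB; first exact/bmfX/bmf_tnth.
apply: bmf_psi; apply: bmfD; last exact: bmf_cst.
by apply: bmfM; [exact: bmf_cst|exact: bmf_local_field].
Qed.

Lemma norm_resid p k x : box x -> `|resid p k x| <= 2 * K ^+ p.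
Proof.
move=> bx; rewrite (le_trans (ler_normB _ _))// mulr_natl mulr2n lerD ?norm_psi//.
rewrite normrX lerXn2r ?nnegrE ?box_norm//.
exact: ltW (supp_bound_gt0 _ _).
Qed.

(* Conditionally on the other coordinates, [x_k] has the law of [mu] tilted by
   [b m_k + h], so the residual is conditionally centred. *)
Lemma gexp_resid p k (G : tT -> R) : bmf box G ->
  (forall z x, G (upd k z x) = G x) ->
  gexp (fun x => resid p k x * G x) = 0.
Proof.
move=> bG Gk.
(* As functions of the new value [z], all factors are constant except the tilt and the residual. The
   fibre integral is thus a multiple of [mom p - psi p * mom 0] at the tilt b m_k + h, which is
   0. *)
have E x z : resid p k (upd k z x) * G (upd k z x) * weight (upd k z x) =
    G x * weight (upd k 0 x) * (z ^+ p * expR ((b * m x k + h) * z)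
      - psi p (b * m x k + h) * (z ^+ 0 * expR ((b * m x k + h) * z))).
  rewrite Gk /resid /weight tnth_upd eqxx local_field_upd//.
  by rewrite hamiltonian_upd// expRD expr0; ring.
have b1 (q : nat) (t : R) : bmf `[km, kp]%classic (fun z : measurableTypeR R => z ^+ q * expR (t * z)).
  exact: bmf_tilt.
apply: (@int_resample0 _ _ _ mu _ k).
- apply: (bmf_integrable mbox fbox); apply: bw; apply: bmfM => //.
  exact: bmf_resid.
- move=> x; under eq_fun do rewrite E.
  apply: (bmf_integrable mB muB); apply: bmfM; first exact: bmf_cst.
  exact: (bmfB (b1 p _) (bmfM (bmf_cst _ _) (b1 0%N _))).
- move=> x; under eq_Rintegral do rewrite E.
  rewrite (intZl mB muB); last first.
    exact: (bmfB (b1 p _) (bmfM (bmf_cst _ _) (b1 0%N _))).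
  rewrite (intB mB muB (b1 p _) (bmfM (bmf_cst _ _) (b1 0%N _))) (intZl mB muB _ (b1 0%N _)).
  rewrite -!/(mom _ _) [X in _ - X](_ : _ = mom p (b * m x k + h)) ?subrr ?mulr0//.
  by rewrite divfK// gt_eqF// (mom0_gt0 muB).
Qed.

End gibbs_expectation.

(* [lra] and [ring] compare atoms up to conversion: keep these folded. *)
#[global] Opaque supp_bound mom psi.

(** * Second moments of weighted residual sums *)

Section second_moment.
Context (R : realType) (km kp : R) (mu : probability (measurableTypeR R) R).
Hypotheses (lek : km <= kp) (muB : mu `[km, kp]%classic = 1%E).
Variables (N : nat) (A : 'I_N -> 'I_N -> 'I_N -> R) (b h gamma : R).
Hypothesis cA : coupling_tensor A.
Hypothesis gA : forall i, \sum_j \sum_k A i j k <= gamma.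
Local Notation K := (supp_bound km kp).
Local Notation psi := (psi mu).
Local Notation tT := (N.-tuple (measurableTypeR R)).
Local Notation m := (local_field A).
Local Notation box := (@box R km kp N).
Local Notation gexp := (gexp mu A b h).
Local Notation resid := (resid mu A b h).

(** [a k l] bounds the influence of x_k on [g l], measured against the reference value [km], a point
    of the support interval, so that the substitution stays in the box. One constant serves as
    uniform bound and as total influence per site, so the second-moment bound depends on a single
    number. *)
Definition slowly_varying (C : R) (g : 'I_N -> tT -> R) : Prop :=
  [/\ forall l, bmf box (g l),
      forall l x, box x -> `|g l x| <= C,
      forall l z x, g l (upd l z x) = g l x &
      exists a : 'I_N -> 'I_N -> R,
        [/\ forall k l, 0 <= a k l,
            forall k l x, box x -> `|g l x - g l (upd k km x)| <= a k l &
            \sum_k \sum_l a k l <= C * N%:R]].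

Lemma slowly_varying_le C C' g : C <= C' ->
  slowly_varying C g -> slowly_varying C' g.
Proof.
move=> CC' [g1 g2 g3 [a [a1 a2 a3]]]; split => //.
  by move=> l x /(g2 l) /le_trans; apply.
by exists a; split => //; rewrite (le_trans a3)// ler_wpM2r.
Qed.

Let K0 : 0 <= K. Proof. exact: ltW (supp_bound_gt0 _ _). Qed.

Lemma norm_sub_km x i : box x -> `|tnth x i - km| <= 2 * K.
Proof.
move=> bx; rewrite (le_trans (ler_normB _ _))// mulr_natl mulr2n lerD ?(box_norm _ bx)//.
by rewrite norm_le_supp_bound// lexx lek.
Qed.

Lemma norm_linear_le (M : 'I_N -> R) x : box x ->
  `|\sum_j M j * tnth x j| <= K * \sum_j `|M j|.
Proof.
move=> bx; rewrite (le_trans (ler_norm_sum _ _ _))// mulr_sumr ler_sum// => j _.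
by rewrite normrM mulrC ler_wpM2r// box_norm.
Qed.

Lemma norm_qform_le (B : 'I_N -> 'I_N -> R) x : box x ->
  `|qform B x| <= K ^+ 2 * \sum_j \sum_k `|B j k|.
Proof.
move=> bx; rewrite (le_trans (ler_norm_sum _ _ _))// mulr_sumr ler_sum// => j _.
rewrite (le_trans (ler_norm_sum _ _ _))// mulr_sumr ler_sum// => k _.
rewrite !normrM -mulrA mulrC ler_wpM2r// expr2.
by rewrite ler_pM// box_norm.
Qed.

Lemma slowly_varying_cst (C : R) (c : 'I_N -> R) :
  (forall l, `|c l| <= C) -> slowly_varying C (fun l _ => c l).
Proof.
move=> cC; split => //; first by move=> l; exact: bmf_cst.
exists (fun _ _ => 0); split => //.
  by move=> k l x _; rewrite subrr normr0.
rewrite big1 => [|k _]; last by rewrite big1.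
case: N c cC => [|n] c cC; first by rewrite mulr0.
by rewrite mulr_ge0// (le_trans _ (cC ord0)).
Qed.

(** Moving x_k to [km] changes the [l]-th form by at most [2 * K] times its coefficient [M l k], so
    the total influence is controlled by the row sums of [M]. *)
Lemma slowly_varying_linear (C : R) (M : 'I_N -> 'I_N -> R) :
  (forall l, M l l = 0) -> (forall l, \sum_j `|M l j| <= C) ->
  slowly_varying (2 * K * C) (fun l x => \sum_j M l j * tnth x j).
Proof.
move=> M0 MC; split.
- move=> l; apply: bmf_sum => j; apply: bmfM; [exact: bmf_cst|exact: bmf_tnth].
- move=> l x bx; rewrite (le_trans (norm_linear_le _ bx))//.
  apply: (le_trans (ler_wpM2l K0 (MC l))).
  have C0 : 0 <= C by rewrite (le_trans _ (MC l))// sumr_ge0.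
  by rewrite -mulrA ler_peMl ?mulr_ge0// ler1n.
- by move=> l z x; rewrite linear_upd0.
exists (fun k l => 2 * K * `|M l k|); split.
- by move=> k l; rewrite !mulr_ge0.
- move=> k l x bx.
  rewrite -{1}(upd_id k x) linear_upd [X in _ - X]linear_upd.
  rewrite (_ : _ - _ = (tnth x k - km) * M l k); last by ring.
  by rewrite normrM ler_wpM2r// norm_sub_km.
rewrite exchange_big /=.
rewrite (_ : N%:R = \sum_(l < N) 1 :> R); last first.
  by rewrite sumr_const card_ord.
rewrite mulr_sumr ler_sum// => l _; rewrite -mulr_sumr mulr1 ler_wpM2l//.
by rewrite mulr_ge0.
Qed.

(** The influence of x_k is at most [2 * K ^+ 2] times the mass of row and column [k] of [B l].
    Summing over [k] counts every entry twice, whence the factor 4. *)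
Lemma slowly_varying_qform (C : R) (B : 'I_N -> 'I_N -> 'I_N -> R) :
  (forall l k, B l l k = 0) -> (forall l k, B l k l = 0) ->
  (forall l k, B l k k = 0) -> (forall l, \sum_j \sum_k `|B l j k| <= C) ->
  slowly_varying (4 * K ^+ 2 * C) (fun l x => qform (B l) x).
Proof.
move=> B1 B2 B3 BC.
have K20 : 0 <= K ^+ 2 by rewrite exprn_ge0.
split.
- move=> l; apply: bmf_sum => j; apply: bmf_sum => k.
  by apply: bmfM (bmf_tnth _ _ k); apply: bmfM (bmf_tnth _ _ j); exact: bmf_cst.
- move=> l x bx; rewrite (le_trans (norm_qform_le _ bx))//.
  apply: (le_trans (ler_wpM2l K20 (BC l))).
  have C0 : 0 <= C by rewrite (le_trans _ (BC l))// sumr_ge0// => *; rewrite sumr_ge0.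
  by rewrite -mulrA ler_peMl ?mulr_ge0// ler1n.
- by move=> l z x; rewrite qform_upd0.
exists (fun k l => 2 * K ^+ 2 * \sum_j (`|B l k j| + `|B l j k|)); split.
- by move=> k l; rewrite !mulr_ge0// sumr_ge0// => j _; rewrite addr_ge0.
- move=> k l x bx.
  rewrite -{1}(upd_id k x) qform_upd// [X in _ - X]qform_upd//.
  set s := \sum_j _; rewrite (_ : _ - _ = (tnth x k - km) * s); last by ring.
  rewrite normrM (_ : 2 * _ * _ = 2 * K * (K * \sum_j (`|B l k j| + `|B l j k|))); last by ring.
  rewrite ler_pM ?norm_sub_km// (le_trans (norm_linear_le _ bx))// ler_wpM2l//.
  by rewrite ler_sum// => j _; exact: ler_normD.
rewrite exchange_big /=.
rewrite (_ : N%:R = \sum_(l < N) 1 :> R); last first.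
  by rewrite sumr_const card_ord.
rewrite mulr_sumr ler_sum// => l _; rewrite -mulr_sumr mulr1.
rewrite (_ : 4 * _ * _ = 2 * K ^+ 2 * (C + C)); last by ring.
rewrite ler_wpM2l ?mulr_ge0//.
under eq_bigr do rewrite big_split /=.
by rewrite big_split /= lerD ?BC// exchange_big /= BC.
Qed.

Lemma row_mass_le l : \sum_k \sum_j `|A l k j| <= gamma.
Proof.
rewrite (eq_bigr (fun k => \sum_j A l k j)) ?gA// => k _.
by apply: eq_bigr => j _; rewrite ger0_norm ?coupling_ge0.
Qed.

Lemma slowly_varying_local_field :
  slowly_varying (4 * K ^+ 2 * gamma) (fun l x => m x l).
Proof.
apply: (slowly_varying_qform (B := A)).
- exact: coupling_diag12.
- exact: coupling_diag13.
- exact: coupling_diag23.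
- exact: row_mass_le.
Qed.

Lemma local_field_variation k l x : box x ->
  `|m x l - m (upd k km x) l| <= 4 * K ^+ 2 * \sum_j A l k j.
Proof.
move=> bx; rewrite -{1}(upd_id k x) local_field_upd_ne// [X in _ - X]local_field_upd_ne//.
set s := \sum_j _; rewrite (_ : _ - _ = 2 * ((tnth x k - km) * s)); last by ring.
rewrite normrM ger0_norm// normrM.
rewrite (_ : 4 * _ * _ = 2 * (2 * K * (K * \sum_j A l k j))); last by ring.
rewrite ler_wpM2l// ler_pM ?norm_sub_km// (le_trans (norm_linear_le _ bx))//.
rewrite ler_wpM2l// (eq_bigr (A l k))// => j _.
by rewrite ger0_norm ?coupling_ge0.
Qed.

(** The first term bounds a diagonal product. The second is the bound of [gexp_resid2] summed over
    pairs, per site: the row masses contribute at most [gamma] and the influences at most [C]. *)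
Definition resid_const (p : nat) (C : R) : R :=
  4 * K ^+ p ^+ 2 * C ^+ 2
  + 2 * K ^+ p * C * (8 * K ^+ p * K ^+ 3 * `|b| * gamma * C + 2 * K ^+ p * C).

Lemma resid_variation p k l x : k != l -> box x ->
  `|resid p l x - resid p l (upd k km x)| <=
  8 * K ^+ p * K ^+ 3 * `|b| * \sum_j A l k j.
Proof.
move=> kl bx; rewrite /resid tnth_upd (negbTE (_ : l != k)) 1?eq_sym//.
set u := m x l; set v := m _ l.
have E (w y z : R) : w - y - (w - z) = z - y by ring.
rewrite E.
rewrite (le_trans (psi_lip muB _ _ _))//.
rewrite (_ : b * v + h - (b * u + h) = b * (v - u)); last by ring.
rewrite normrM exprS distrC.
rewrite (_ : 8 * _ * _ * _ * _ =
  2 * (K * K ^+ p) * (`|b| * (4 * K ^+ 2 * \sum_j A l k j))); last by ring.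
rewrite ler_wpM2l ?mulr_ge0 ?exprn_ge0// ler_wpM2l//.
exact: local_field_variation.
Qed.

Lemma gexp_norm_le F (c : R) : bmf box F -> (forall x, box x -> `|F x| <= c) ->
  `|gexp F| <= c.
Proof.
move=> bF Fc; rewrite ler_norml; apply/andP; split.
  rewrite -[leLHS](gexp_cst muB A b h); apply: (le_gexp muB) => //; first exact: bmf_cst.
  by move=> x /Fc; rewrite ler_norml => /andP[].
by apply: (gexp_le muB) => // x /Fc; rewrite ler_norml => /andP[].
Qed.

(** Freezing x_k at [km] in the factors of site [l] leaves the residual at [k] multiplied by
    something free of x_k, so that product has mean zero. What remains is the change of
    [resid p l x * g l x] caused by the freezing. *)
Lemma gexp_resid2 p C g k l (a : R) : slowly_varying C g -> k != l ->
  (forall x, box x -> `|g l x - g l (upd k km x)| <= a) ->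
  `|gexp (fun x => resid p k x * g k x * (resid p l x * g l x))| <=
  2 * K ^+ p * C * (8 * K ^+ p * K ^+ 3 * `|b| * (\sum_j A l k j) * C + 2 * K ^+ p * a).
Proof.
move=> [g1 g2 g3 _] kl ga.
have Kp : 0 <= K ^+ p by rewrite exprn_ge0.
pose F x := resid p l x * g l x.
have bF : bmf box F by apply: bmfM => //; exact: bmf_resid.
have bR i : bmf box (resid p i) by exact: bmf_resid.
have bG : bmf box (fun x => F (upd k km x)).
  have [mF [c Fc]] := bF; split.
    apply: (measurableT_comp mF).
    have mp : measurable_fun setT (fun x : tT => (x, km : measurableTypeR R)).
      by apply: measurable_fun_pair => //; exact: measurable_cst.
    exact: (measurableT_comp (measurable_upd k) mp).
  by exists c => x bx; apply/Fc/box_upd.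
have E0 : gexp (fun x => resid p k x * (g k x * F (upd k km x))) = 0.
  apply: (gexp_resid muB) => //; first exact: bmfM.
  by move=> z x; rewrite g3 upd_upd.
rewrite -[gexp _]subr0 -[X in _ - X]E0 -(gexpB muB); last 2 first.
- by apply: bmfM => //; exact: bmfM.
- by apply: bmfM => //; exact: bmfM.
apply: gexp_norm_le.
  by apply: bmfB; apply: bmfM => //; exact: bmfM.
move=> x bx.
have E1 (u w z z' : R) : u * w * z - u * (w * z') = u * w * (z - z') by ring.
rewrite E1.
rewrite !normrM ler_pM ?mulr_ge0//.
  by rewrite ler_pM ?g2//; exact: norm_resid.
have E (u u' w w' : R) : u * w - u' * w' = (u - u') * w + u' * (w - w') by ring.
rewrite /F E.
rewrite (le_trans (ler_normD _ _))// !normrM lerD// ler_pM//.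
- exact: resid_variation.
- exact: g2.
- by apply: norm_resid => //; exact: box_upd.
- exact: ga.
Qed.

Lemma gexp_sum_resid p C g : slowly_varying C g ->
  gexp (fun x => (\sum_k resid p k x * g k x) ^+ 2) <= resid_const p C * N%:R.
Proof.
move=> sg; have [g1 g2 g3 [a [a1 a2 a3]]] := sg.
have Kp : 0 <= K ^+ p by rewrite exprn_ge0.
have bt k : bmf box (fun x => resid p k x * g k x).
  by apply: bmfM => //; exact: bmf_resid.
have -> : (fun x : tT => (\sum_k resid p k x * g k x) ^+ 2) =
    (fun x => \sum_k \sum_l resid p k x * g k x * (resid p l x * g l x)).
  apply/funext => x; rewrite expr2 mulr_suml; apply: eq_bigr => k _.
  by rewrite mulr_sumr.
rewrite (gexp_sum muB); last by move=> k; apply: bmf_sum => l; exact: bmfM.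
case: (posnP N) => [N0|N0].
  rewrite big1 => [|k _]; last first.
    by have := leq_trans (leq_ltn_trans (leq0n _) (ltn_ord k)) (eq_leq N0).
  by rewrite (_ : N%:R = 0 :> R) ?mulr0// N0.
have C0 : 0 <= C.
  pose x0 : tT := [tuple km | _ < N].
  rewrite (le_trans _ (g2 (Ordinal N0) x0 _))// => i.
  by rewrite tnth_mktuple /= in_itv /= lexx lek.
pose r l k := \sum_j A l k j.
have r0 l k : 0 <= r l k by rewrite sumr_ge0// => j _; rewrite coupling_ge0.
pose c k l := 2 * K ^+ p * C * (8 * K ^+ p * K ^+ 3 * `|b| * r l k * C + 2 * K ^+ p * a k l).
have c0 k l : 0 <= c k l.
  by rewrite !mulr_ge0// addr_ge0 ?mulr_ge0// exprn_ge0.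
apply: (@le_trans _ _ (\sum_k \sum_l
  ((l == k)%:R * (4 * K ^+ p ^+ 2 * C ^+ 2) + c k l))).
  apply: ler_sum => k _; rewrite (gexp_sum muB); last by move=> l; exact: bmfM.
  apply: ler_sum => l _; case: eqVneq => [->|lk].
    rewrite mul1r (le_trans (ler_norm _))//.
    apply: (@le_trans _ _ (4 * K ^+ p ^+ 2 * C ^+ 2)); last by rewrite lerDl.
    apply: gexp_norm_le; first exact: bmfM.
    move=> x bx; rewrite (_ : 4 * _ * _ = 2 * K ^+ p * C * (2 * K ^+ p * C)); last by ring.
    by rewrite !normrM; do 2 (rewrite ler_pM ?mulr_ge0//); rewrite ?g2//; exact: norm_resid.
  rewrite mul0r add0r (le_trans (ler_norm _))// gexp_resid2// 1?eq_sym//.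
  by move=> x; exact: a2.
set q := 4 * K ^+ p ^+ 2 * C ^+ 2.
have -> : \sum_k \sum_l ((l == k)%:R * q + c k l) = q * N%:R + \sum_k \sum_l c k l.
  under eq_bigr do rewrite big_split /= sum_delta.
  by rewrite big_split /= sumr_const card_ord mulr_natr.
rewrite /resid_const -/q [X in _ <= X]mulrDl lerD2l.
rewrite (_ : \sum_k \sum_l c k l = 2 * K ^+ p * C *
  (8 * K ^+ p * K ^+ 3 * `|b| * C * (\sum_l \sum_k r l k) + 2 * K ^+ p * (\sum_k \sum_l a k l))); last first.
  rewrite (exchange_big _ _ _ _ _ r) /= !mulr_sumr -big_split /= mulr_sumr.
  apply: eq_bigr => k _; rewrite !mulr_sumr -big_split /= mulr_sumr.
  by apply: eq_bigr => l _; rewrite /c; ring.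
rewrite -[X in _ <= X]mulrA ler_wpM2l ?mulr_ge0//.
rewrite (mulrDl (8 * _ * _ * _ * _ * _)) lerD//.
  rewrite (_ : 8 * _ * _ * _ * _ * _ * _ = 8 * K ^+ p * K ^+ 3 * `|b| * C * (gamma * N%:R)); last by ring.
  rewrite ler_wpM2l ?mulr_ge0 ?exprn_ge0//.
  rewrite (_ : N%:R = \sum_(l < N) 1 :> R); last by rewrite sumr_const card_ord.
  by rewrite mulr_sumr ler_sum// => l _; rewrite mulr1 gA.
by rewrite -[X in _ <= X]mulrA ler_wpM2l ?mulr_ge0.
Qed.

End second_moment.

(** * Averages over the sites *)

Section averages.
Context (R : realType) (N : nat).
Implicit Types F G : 'I_N -> R.

Definition avg F : R := N%:R^-1 * \sum_i F i.

Lemma eq_avg F G : F =1 G -> avg F = avg G.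
Proof. by move=> FG; rewrite /avg; congr (_ * _); apply: eq_bigr => i _. Qed.

Lemma avgD F G : avg (fun i => F i + G i) = avg F + avg G.
Proof. by rewrite /avg big_split mulrDr. Qed.

Lemma avgB F G : avg (fun i => F i - G i) = avg F - avg G.
Proof. by rewrite /avg sumrB mulrBr. Qed.

Lemma avgZ c F : avg (fun i => c * F i) = c * avg F.
Proof. by rewrite /avg -mulr_sumr mulrCA. Qed.

Lemma le_avg F G : (forall i, F i <= G i) -> avg F <= avg G.
Proof. by move=> FG; rewrite /avg ler_wpM2l ?invr_ge0// ler_sum. Qed.

Lemma avg_ge0 F : (forall i, 0 <= F i) -> 0 <= avg F.
Proof. by move=> F0; rewrite /avg mulr_ge0 ?invr_ge0// sumr_ge0. Qed.

Lemma norm_avg F : `|avg F| <= avg (fun i => `|F i|).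
Proof.
by rewrite /avg normrM ger0_norm ?invr_ge0// ler_wpM2l ?invr_ge0// ler_norm_sum.
Qed.

Lemma avg_exchange (F : 'I_N -> 'I_N -> R) :
  avg (fun i => \sum_j F i j) = avg (fun j => \sum_i F i j).
Proof. by rewrite /avg exchange_big. Qed.

Hypothesis N0 : (0 < N)%N.

Lemma avg_cst c : avg (fun=> c) = c.
Proof.
by rewrite /avg sumr_const card_ord -[c *+ _]mulr_natl mulrA mulVf ?mul1r// pnatr_eq0 -lt0n.
Qed.

Lemma avg_le_cst F c : (forall i, F i <= c) -> avg F <= c.
Proof. by move=> Fc; rewrite -[leRHS]avg_cst; exact: le_avg. Qed.

(** The variance of [|F i|] over the sites is nonnegative. *)
Lemma avg_norm_sqr F : (avg (fun i => `|F i|)) ^+ 2 <= avg (fun i => F i ^+ 2).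
Proof.
set a := avg _; have : 0 <= avg (fun i => (`|F i| - a) ^+ 2).
  by apply: avg_ge0 => i; exact: sqr_ge0.
rewrite (eq_avg (G := fun i => F i ^+ 2 - 2 * a * `|F i| + a ^+ 2)); last first.
  by move=> i; rewrite sqrrB real_normK ?num_real//; ring.
by rewrite avgD avgB avgZ avg_cst -/a; lra.
Qed.

Lemma avg_sqr_dev F : avg (fun i => (F i - avg F) ^+ 2) = avg (fun i => F i ^+ 2) - avg F ^+ 2.
Proof.
rewrite (eq_avg (G := fun i => F i ^+ 2 - 2 * avg F * F i + avg F ^+ 2)); last first.
  by move=> i; ring.
by rewrite avgD avgB avgZ avg_cst; ring.
Qed.

End averages.

(** * Coefficient families and their summation identities *)

Section degenerate_samples.
Context (R : realType) (km kp : R) (mu : probability (measurableTypeR R) R).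
Hypotheses (lek : km <= kp) (muB : mu `[km, kp]%classic = 1%E).
Variables (N : nat) (A : 'I_N -> 'I_N -> 'I_N -> R) (b h gamma : R).
Hypothesis N0 : (0 < N)%N.
Hypothesis cA : coupling_tensor A.
Hypothesis gA : forall i, \sum_j \sum_k A i j k <= gamma.
Local Notation K := (supp_bound km kp).
Local Notation psi := (psi mu).
Local Notation tT := (N.-tuple (measurableTypeR R)).
Local Notation m := (local_field A).
Local Notation box := (@box R km kp N).
Local Notation resid := (resid mu A b h).
Local Notation rho := (row_mass1 A).

Definition row_mass (i j : 'I_N) : R := \sum_k A i j k.
Local Notation r := row_mass.

Lemma row_mass_ge0 i j : 0 <= r i j.
Proof. by rewrite sumr_ge0// => k _; exact: coupling_ge0. Qed.

Lemma row_mass_sym i j : r i j = r j i.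
Proof. by apply: eq_bigr => k _; rewrite coupling_sym12. Qed.

Lemma gamma_ge0 : 0 <= gamma.
Proof.
by apply: le_trans (gA (Ordinal N0)); rewrite sumr_ge0// => j _; exact: row_mass_ge0.
Qed.

Lemma sum_row_mass_le i : \sum_j r i j <= gamma. Proof. exact: gA. Qed.

Lemma row_mass_le_gamma i j : r i j <= gamma.
Proof.
apply: le_trans (gA i); rewrite [leRHS](bigD1 j)//= lerDl sumr_ge0// => k _.
exact: row_mass_ge0.
Qed.

Lemma rho_ge0 i : 0 <= rho i.
Proof. by rewrite sumr_ge0// => j _; exact: row_mass_ge0. Qed.

(* The coefficients attached to [x_k] in [\sum_i w_i m_i]. *)
Definition field_coef (w : 'I_N -> R) (k : 'I_N) (x : tT) : R :=
  \sum_j (\sum_i w i * A i j k) * tnth x j.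

(** The coefficient of x_j in the sum over [k] of [field_coef w k]. Removing the x's one after the
    other leads from sum_i w_i m_i through these coefficients to sum_i w_i R_i. *)
Definition mass_coef (w : 'I_N -> R) (j : 'I_N) (_ : tT) : R := \sum_i w i * r i j.

(** Coefficients of the quadratic form sum_i r_il m_i; its entries with j = l or k = l carry the
    dependence on x_l. *)
Definition paired_mass (l j k : 'I_N) : R := \sum_i r i l * A i j k.

(* [\sum_i r i l * m_i] with its dependence on [x_l] removed. *)
Definition reduced_field (l : 'I_N) (x : tT) : R :=
  qform (fun j k => (j != l)%:R * (k != l)%:R * paired_mass l j k) x.

(** Half the slope in x_l of sum_i r_il m_i: the index [l] can take either of two positions, which
    explains the 2 in [mass_fieldE]. *)
Definition self_coef (l : 'I_N) (x : tT) : R := \sum_k paired_mass l l k * tnth x k.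

Definition self_mass (k : 'I_N) (_ : tT) : R := \sum_l paired_mass l l k.

Lemma paired_mass_ge0 l j k : 0 <= paired_mass l j k.
Proof. by rewrite sumr_ge0// => i _; rewrite mulr_ge0 ?row_mass_ge0 ?coupling_ge0. Qed.

Lemma paired_mass_sym l j k : paired_mass l j k = paired_mass l k j.
Proof. by apply: eq_bigr => i _; rewrite coupling_sym23. Qed.

Lemma paired_mass_diag l k : paired_mass l k k = 0.
Proof. by rewrite /paired_mass big1// => i _; rewrite coupling_diag23// mulr0. Qed.

Lemma sum_paired_mass l : \sum_j \sum_k paired_mass l j k <= gamma ^+ 2.
Proof.
rewrite (_ : \sum_j _ = \sum_i r i l * rho i).
  apply: (@le_trans _ _ (\sum_i r i l * gamma)).
    by rewrite ler_sum// => i _; rewrite ler_wpM2l ?row_mass_ge0 ?gA.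
  rewrite -mulr_suml expr2 ler_wpM2r ?gamma_ge0//.
  by under eq_bigr do rewrite row_mass_sym; exact: sum_row_mass_le.
under eq_bigr do rewrite exchange_big /=.
rewrite exchange_big /=; apply: eq_bigr => i _.
by rewrite mulr_sumr; apply: eq_bigr => j _; rewrite mulr_sumr.
Qed.

Lemma slowly_varying_field_coef (w : 'I_N -> R) (W : R) :
  (forall i, 0 <= w i <= W) ->
  slowly_varying km kp (2 * K * (W * gamma)) (field_coef w).
Proof.
move=> wW; have W0 : 0 <= W by have /andP[] := wW (Ordinal N0); exact: le_trans.
apply: (slowly_varying_linear lek (M := fun k j => \sum_i w i * A i j k)).
  by move=> k; rewrite big1// => i _; rewrite coupling_diag23// mulr0.
move=> k; apply: (@le_trans _ _ (\sum_j \sum_i W * A i j k)).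
  apply: ler_sum => j _; rewrite ger0_norm.
    apply: ler_sum => i _; rewrite ler_wpM2r ?coupling_ge0//.
    by have /andP[] := wW i.
  rewrite sumr_ge0// => i _; rewrite mulr_ge0 ?coupling_ge0//.
  by have /andP[] := wW i.
under eq_bigr do rewrite -mulr_sumr; rewrite -mulr_sumr ler_wpM2l//.
apply: le_trans (gA k); apply: ler_sum => j _; apply: ler_sum => i _.
by rewrite coupling_sym13// coupling_sym23.
Qed.

Lemma slowly_varying_mass_coef (w : 'I_N -> R) (W : R) :
  (forall i, 0 <= w i <= W) ->
  slowly_varying km kp (W * gamma) (mass_coef w).
Proof.
move=> wW; have W0 : 0 <= W by have /andP[] := wW (Ordinal N0); exact: le_trans.
apply: slowly_varying_cst => j; rewrite /mass_coef.
rewrite ger0_norm; last first.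
  rewrite sumr_ge0// => i _; rewrite mulr_ge0 ?row_mass_ge0//.
  by have /andP[] := wW i.
apply: (@le_trans _ _ (\sum_i W * r j i)); last first.
  by rewrite -mulr_sumr ler_wpM2l// sum_row_mass_le.
apply: ler_sum => i _; rewrite row_mass_sym ler_wpM2r ?row_mass_ge0//.
by have /andP[] := wW i.
Qed.

Lemma slowly_varying_reduced_field :
  slowly_varying km kp (4 * K ^+ 2 * gamma ^+ 2) reduced_field.
Proof.
apply: (slowly_varying_qform lek
  (B := fun l j k => (j != l)%:R * (k != l)%:R * paired_mass l j k)).
- by move=> l k; rewrite eqxx !mul0r.
- by move=> l k; rewrite eqxx mulr0 mul0r.
- by move=> l k; rewrite paired_mass_diag mulr0.
move=> l; apply: le_trans (sum_paired_mass l).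
apply: ler_sum => j _; apply: ler_sum => k _.
rewrite normrM (ger0_norm (paired_mass_ge0 _ _ _)) ler_piMl ?paired_mass_ge0//.
by case: (j != l); case: (k != l); rewrite ?(mulr1, mulr0) ?normr1 ?normr0.
Qed.

Lemma slowly_varying_self_coef :
  slowly_varying km kp (2 * K * gamma ^+ 2) self_coef.
Proof.
apply: (slowly_varying_linear lek (M := fun l k => paired_mass l l k)).
  by move=> l; exact: paired_mass_diag.
move=> l; apply: le_trans (sum_paired_mass l).
rewrite [leRHS](bigD1 l)//= (eq_bigr (paired_mass l l)); last first.
  by move=> k _; rewrite ger0_norm// paired_mass_ge0.
by rewrite lerDl sumr_ge0// => j _; rewrite sumr_ge0// => k _; exact: paired_mass_ge0.
Qed.

Lemma slowly_varying_self_mass : slowly_varying km kp (gamma ^+ 2) self_mass.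
Proof.
apply: slowly_varying_cst => k; rewrite /self_mass.
rewrite ger0_norm; last by rewrite sumr_ge0// => l _; exact: paired_mass_ge0.
apply: (@le_trans _ _ (\sum_l \sum_i gamma * A k l i)).
  apply: ler_sum => l _; apply: ler_sum => i _.
  by rewrite ler_pM ?row_mass_ge0 ?coupling_ge0 ?row_mass_le_gamma// coupling_sym13// coupling_sym23 -1?coupling_sym23.
under eq_bigr do rewrite -mulr_sumr; rewrite -mulr_sumr expr2 ler_wpM2l ?gamma_ge0//.
Qed.

Lemma sum_weighted_field (w : 'I_N -> R) (x : tT) :
  \sum_i w i * m x i = \sum_k tnth x k * field_coef w k x.
Proof.
transitivity (\sum_i \sum_j \sum_k w i * A i j k * tnth x j * tnth x k).
  apply: eq_bigr => i _; rewrite mulr_sumr; apply: eq_bigr => j _.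
  by rewrite mulr_sumr; apply: eq_bigr => k _; ring.
under eq_bigr do rewrite exchange_big /=.
rewrite exchange_big /=; apply: eq_bigr => k _.
rewrite exchange_big /= mulr_sumr; apply: eq_bigr => j _.
by rewrite mulr_suml mulr_sumr; apply: eq_bigr => i _; ring.
Qed.

Lemma sum_field_coef (w : 'I_N -> R) (x : tT) :
  \sum_k field_coef w k x = \sum_j tnth x j * mass_coef w j x.
Proof.
rewrite exchange_big /=; apply: eq_bigr => j _.
rewrite -mulr_suml mulrC; congr (_ * _).
by rewrite exchange_big /=; apply: eq_bigr => i _; rewrite mulr_sumr.
Qed.

Lemma sum_mass_coef (w : 'I_N -> R) (x : tT) :
  \sum_j mass_coef w j x = \sum_i w i * rho i.
Proof. by rewrite exchange_big /=; apply: eq_bigr => i _; rewrite mulr_sumr. Qed.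

Lemma mass_fieldE (l : 'I_N) (x : tT) :
  \sum_i r i l * m x i = reduced_field l x + 2 * (tnth x l * self_coef l x).
Proof.
transitivity (qform (paired_mass l) x).
  transitivity (\sum_i \sum_j \sum_k r i l * A i j k * tnth x j * tnth x k).
    apply: eq_bigr => i _; rewrite mulr_sumr; apply: eq_bigr => j _.
    by rewrite mulr_sumr; apply: eq_bigr => k _; ring.
  rewrite exchange_big /=; apply: eq_bigr => j _.
  rewrite exchange_big /=; apply: eq_bigr => k _.
  by rewrite /paired_mass !mulr_suml.
rewrite -{1}(upd_id l x) qform_upd ?paired_mass_diag//; congr (_ + _).
  apply: eq_bigr => j _; apply: eq_bigr => k _; rewrite !tnth_upd.
  case: eqP => _; first by rewrite !(mulr0, mul0r).
  by case: eqP => _; rewrite ?(mulr0, mul0r) ?mul1r.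
rewrite mulrCA; congr (_ * _); rewrite mulr_sumr; apply: eq_bigr => k _.
by rewrite (paired_mass_sym l k l); ring.
Qed.

Lemma sum_self_coef (x : tT) :
  \sum_l self_coef l x = \sum_k tnth x k * self_mass k x.
Proof.
by rewrite exchange_big /=; apply: eq_bigr => k _; rewrite -mulr_suml mulrC.
Qed.

(** Summing [A i l k] over [k] yields r_il once more, so the total is the sum of the squares r_il^2,
    and R is symmetric. *)
Lemma sum_self_mass (x : tT) : \sum_k self_mass k x = \tr (row_mass2 A ^+ 2).
Proof.
rewrite exchange_big /= expr2 /mxtrace; apply: eq_bigr => l _.
rewrite !mxE exchange_big /=; apply: eq_bigr => i _.
by rewrite -mulr_sumr !mxE -/(r i l) -/(r l i) row_mass_sym.
Qed.

End degenerate_samples.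

(** * Approximate identities on samples with small T_N *)

Section degenerate_bounds.
Context (R : realType) (km kp : R) (mu : probability (measurableTypeR R) R).
Hypotheses (lek : km <= kp) (muB : mu `[km, kp]%classic = 1%E).
Variables (N : nat) (A : 'I_N -> 'I_N -> 'I_N -> R) (b h gamma : R).
Hypothesis N0 : (0 < N)%N.
Hypothesis cA : coupling_tensor A.
Hypothesis gA : forall i, \sum_j \sum_k A i j k <= gamma.
Local Notation K := (supp_bound km kp).
Local Notation psi := (psi mu).
Local Notation tT := (N.-tuple (measurableTypeR R)).
Local Notation m := (local_field A).
Local Notation mbar := (mean_field A).
Local Notation box := (@box R km kp N).
Local Notation resid := (resid mu A b h).
Local Notation rho := (row_mass1 A).
Local Notation r := (row_mass A).

Let K0 : 0 <= K. Proof. exact: ltW (supp_bound_gt0 _ _). Qed.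
Let K1 : 1 <= K. Proof. exact: supp_bound_ge1. Qed.
Let g0 : 0 <= gamma. Proof. exact: (gamma_ge0 N0 cA gA). Qed.

(** One bound for all test families: their constants contain at most [4 * K ^+ 2], and
    [(1 + gamma) ^+ 2] dominates both [gamma] and [gamma ^+ 2]. *)
Definition coef_bound : R := 4 * K ^+ 2 * (1 + gamma) ^+ 2.
Local Notation G := coef_bound.

(** The first pair yields mbar = c^2 Rbar and the second pair the degree variance relation; the last
    four, together with [mass_coef] of the constant 1, yield the trace relation. The power 2 occurs
    only for the self-interaction term x_l^2. *)
Definition test_families : seq (nat * ('I_N -> tT -> R)) :=
  [:: (1, field_coef A (fun=> 1%R)); (1, mass_coef A (fun=> 1%R));
      (1, field_coef A rho); (1, mass_coef A rho);
      (1, reduced_field A); (1, self_coef A); (2, self_coef A);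
      (1, self_mass A)]%N.

Let le_coef_bound u v : 0 <= u <= 2 -> 0 <= v <= (1 + gamma) ^+ 2 ->
  u * K * v <= G.
Proof.
move=> /andP[u0 u2] /andP[v0 v1]; rewrite /coef_bound ler_pM ?mulr_ge0//.
have : u * K <= 2 * K by rewrite ler_wpM2r.
have : K * 1 <= K ^+ 2 by rewrite expr2 ler_wpM2l.
by have := K0; lra.
Qed.

Lemma slowly_varying_test t : List.In t test_families ->
  slowly_varying km kp G t.2.
Proof.
have gg : gamma <= (1 + gamma) ^+ 2 by rewrite sqrrD; have := sqr_ge0 gamma; have := g0; lra.
have gg2 : gamma ^+ 2 <= (1 + gamma) ^+ 2 by rewrite sqrrD; have := g0; lra.
have g20 : 0 <= gamma ^+ 2 by rewrite sqr_ge0.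
have w1 i : 0 <= (fun _ : 'I_N => 1 : R) i <= 1 by rewrite ler01 lexx.
have wr i : 0 <= rho i <= gamma by rewrite (rho_ge0 cA) gA.
have cst v : 0 <= v <= (1 + gamma) ^+ 2 -> v <= G.
  move=> /[dup]/andP[v0 v1] hv; apply: (@le_trans _ _ (1 * K * v)).
    by rewrite mul1r ler_peMl.
  by apply: le_coef_bound => //; rewrite ler01 ler1n.
have lin v : 0 <= v <= (1 + gamma) ^+ 2 -> 2 * K * v <= G.
  by move=> hv; apply: le_coef_bound => //; rewrite lexx ler0n.
case=> [<-|[<-|[<-|[<-|[<-|[<-|[<-|[<-|//]]]]]]]].
- apply: slowly_varying_le (slowly_varying_field_coef lek N0 cA gA w1).
  by apply: lin; rewrite mul1r g0.
- apply: slowly_varying_le (slowly_varying_mass_coef km kp N0 cA gA w1).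
  by apply: cst; rewrite mul1r g0.
- apply: slowly_varying_le (slowly_varying_field_coef lek N0 cA gA wr).
  by apply: lin; rewrite -expr2 g20.
- apply: slowly_varying_le (slowly_varying_mass_coef km kp N0 cA gA wr).
  by apply: cst; rewrite -expr2 g20.
- apply: slowly_varying_le (slowly_varying_reduced_field lek N0 cA gA).
  by rewrite /coef_bound ler_wpM2l ?mulr_ge0 ?exprn_ge0.
- apply: slowly_varying_le (slowly_varying_self_coef lek N0 cA gA).
  by apply: lin; rewrite g20.
- apply: slowly_varying_le (slowly_varying_self_coef lek N0 cA gA).
  by apply: lin; rewrite g20.
- apply: slowly_varying_le (slowly_varying_self_mass km kp N0 cA gA).
  by apply: cst; rewrite g20.
Qed.

Definition test_stat (x : tT) : R :=
  \sum_(t <- test_families) (\sum_k resid t.1 k x * t.2 k x) ^+ 2.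

Lemma test_stat_le t x : List.In t test_families ->
  (\sum_k resid t.1 k x * t.2 k x) ^+ 2 <= test_stat x.
Proof.
rewrite /test_stat; elim: test_families => //= a s IH [->|ts]; rewrite big_cons.
  by rewrite lerDl sumr_ge0// => i _; exact: sqr_ge0.
by rewrite (le_trans (IH ts))// lerDr sqr_ge0.
Qed.

(** The 1 pays for the residual sum, the other term for replacing b m_k + h by [theta]. The exponent
    3 covers the Lipschitz constants of [psi p] for p <= 2. *)
Definition swap_const : R := 1 + 2 * K ^+ 3 * `|b| * G.
Local Notation kap := swap_const.

Let G0 : 0 <= G.
Proof. by rewrite /coef_bound mulr_ge0 ?sqr_ge0// mulr_ge0 ?sqr_ge0. Qed.

Let lip_ge0 : 0 <= 2 * K ^+ 3 * `|b| * G.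
Proof.
apply: mulr_ge0 => //; apply: mulr_ge0 => //; apply: mulr_ge0 => //.
exact: exprn_ge0.
Qed.

Lemma swap_const_ge1 : 1 <= kap.
Proof. by rewrite /swap_const lerDl. Qed.

Variables (x : tT) (eta : R).
Hypotheses (bx : box x) (eta0 : 0 <= eta).
Hypothesis Tx : T_stat A x <= eta ^+ 2.
Hypothesis Sx : test_stat x <= (N%:R * eta) ^+ 2.

Lemma avg_field_dev : avg (fun i => `|m x i - mbar x|) <= eta.
Proof.
rewrite -(@ler_pXn2r _ 2) ?nnegrE//; last by apply: avg_ge0.
exact: (le_trans (avg_norm_sqr N0 _) Tx).
Qed.

Let theta := b * mbar x + h.
Let c := psi 1 theta.
Let c2 := psi 2 theta.

(** x_k^p is its residual plus [psi p] at b m_k + h. The weighted residuals average to at most [eta]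
    by the bound on [test_stat]; moving [psi p] to [theta] costs a multiple of |m_k - mbar|, whose
    average is at most [eta]. *)
Lemma avg_swap t : List.In t test_families -> (t.1 <= 2)%N ->
  `|avg (fun k => tnth x k ^+ t.1 * t.2 k x) - psi t.1 theta * avg (fun k => t.2 k x)|
  <= kap * eta.
Proof.
move=> ts t2; have [_ gG _ _] := slowly_varying_test ts.
have -> : avg (fun k => tnth x k ^+ t.1 * t.2 k x) - psi t.1 theta * avg (fun k => t.2 k x) =
   avg (fun k => resid t.1 k x * t.2 k x)
   + avg (fun k => (psi t.1 (b * m x k + h) - psi t.1 theta) * t.2 k x).
  have E (u y z w : R) : u * w - z * w = (u - y) * w + (y - z) * w by ring.
  by rewrite -avgZ -avgB -avgD; apply: eq_avg => k; exact: E.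
rewrite /swap_const mulrDl (le_trans (ler_normD _ _))// lerD//.
  rewrite mul1r -(@ler_pXn2r _ 2) ?nnegrE// real_normK ?num_real//.
  rewrite /avg exprMn exprVn ler_pdivrMl ?exprn_gt0 ?ltr0n//.
  by rewrite -exprMn (le_trans (test_stat_le _ ts) Sx).
rewrite (le_trans (norm_avg _))//.
apply: (@le_trans _ _ (avg (fun k => 2 * K ^+ 3 * `|b| * G * `|m x k - mbar x|))); last first.
  by rewrite avgZ ler_wpM2l ?avg_field_dev.
apply: le_avg => k; rewrite normrM.
rewrite (_ : 2 * _ * _ * _ * _ = 2 * K ^+ 3 * (`|b| * `|m x k - mbar x|) * G); last by ring.
rewrite ler_pM ?gG// (le_trans (psi_lip muB _ _ _))//.
rewrite (_ : _ - theta = b * (m x k - mbar x)); last by rewrite /theta; ring.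
by rewrite normrM ler_wpM2r ?mulr_ge0// ler_wpM2l// ler_weXn2l.
Qed.

Let c_le : `|c| <= K. Proof. by have := norm_psi muB 1 theta; rewrite expr1. Qed.

Lemma avg_mean_swap (a : 'I_N -> R) (C : R) : (forall i, `|a i| <= C) ->
  `|avg (fun i => m x i * a i) - mbar x * avg a| <= C * eta.
Proof.
move=> aC; rewrite -avgZ -avgB (le_trans (norm_avg _))//.
apply: (@le_trans _ _ (avg (fun i => C * `|m x i - mbar x|))).
  apply: le_avg => i; rewrite -mulrBl normrM mulrC.
  by rewrite ler_wpM2r.
by rewrite avgZ ler_wpM2l ?avg_field_dev// (le_trans _ (aC (Ordinal N0))).
Qed.

(** Two swaps, each producing a factor [c]: the weighted field is a sum of x_k times [field_coef],
    and the sum of [field_coef] is in turn a sum of x_j times [mass_coef]. *)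
Lemma avg_weighted_field (w : 'I_N -> R) :
  List.In (1%N, field_coef A w) test_families ->
  List.In (1%N, mass_coef A w) test_families ->
  `|avg (fun i => w i * m x i) - c ^+ 2 * avg (fun i => w i * rho i)|
  <= (1 + K) * kap * eta.
Proof.
move=> /avg_swap/(_ isT) h1 /avg_swap/(_ isT) h2.
move: h1 h2; rewrite /= -/c.
set u := avg (fun k => tnth x k ^+ 1 * _).
set u' := avg (fun k => field_coef A w k x).
set v := avg (fun k => tnth x k ^+ 1 * _).
set v' := avg (fun k => mass_coef A w k x) => h1 h2.
have -> : avg (fun i => w i * m x i) = u.
  by rewrite /u /avg sum_weighted_field.
have vu : u' = v.
  by rewrite /v /u' /avg sum_field_coef.
have -> : avg (fun i => w i * rho i) = v' by rewrite /v' /avg sum_mass_coef.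
rewrite (_ : _ - _ = (u - c * u') + c * (v - c * v')); last by rewrite vu; ring.
rewrite (le_trans (ler_normD _ _))// mulrDl mul1r mulrDl lerD// normrM -mulrA.
by rewrite ler_pM.
Qed.

Lemma mean_field_approx :
  `|mbar x - c ^+ 2 * mean_row_mass1 A| <= (1 + K) * kap * eta.
Proof.
have := @avg_weighted_field (fun=> 1) (or_introl erefl) (or_intror (or_introl erefl)).
rewrite (eq_avg (G := m x)); last by move=> i; rewrite mul1r.
by rewrite (eq_avg (F := fun i => 1 * rho i) (G := rho)) // => i; rewrite mul1r.
Qed.

Lemma norm_mean_field : `|mbar x| <= K ^+ 2 * gamma.
Proof.
rewrite (le_trans (norm_avg _))// avg_le_cst// => i.
rewrite (le_trans (norm_qform_le (A i) bx))// ler_wpM2l ?exprn_ge0//.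
exact: (row_mass_le cA gA).
Qed.

(** avg(R_i m_i) is near c^2 avg(R_i^2) by swapping, and near mbar Rbar, hence near c^2 Rbar^2,
    because the m_i are nearly constant. The difference is c^2 times the variance of the R_i. *)
Lemma row_mass_variance_small :
  c ^+ 2 * avg (fun i => (rho i - mean_row_mass1 A) ^+ 2)
  <= (gamma + (1 + gamma) * ((1 + K) * kap)) * eta.
Proof.
have h1 := @avg_weighted_field rho (or_intror (or_intror (or_introl erefl)))
  (or_intror (or_intror (or_intror (or_introl erefl)))).
have h2 := mean_field_approx.
have rg i : `|rho i| <= gamma by rewrite ger0_norm ?gA// (rho_ge0 cA).
have h3 := avg_mean_swap rg.
rewrite (avg_sqr_dev N0) -/(avg rho).
rewrite (eq_avg (F := fun i => m x i * rho i) (G := fun i => rho i * m x i)) in h3;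
  last by move=> i; rewrite mulrC.
rewrite (eq_avg (F := fun i => rho i * rho i) (G := fun i => rho i ^+ 2)) in h1;
  last by move=> i; rewrite expr2.
rewrite -/(mean_row_mass1 A).
set Rb := mean_row_mass1 A in h2 *.
rewrite -[avg (fun i => rho i)]/Rb in h3.
have Rb_le : `|Rb| <= gamma.
  by rewrite (le_trans (norm_avg _))// avg_le_cst.
have h4 : `|(mbar x - c ^+ 2 * Rb) * Rb| <= (1 + K) * kap * eta * gamma.
  by rewrite normrM ler_pM.
set M := avg (fun i => rho i ^+ 2) in h1 *.
set P := avg (fun i => rho i * m x i) in h1 h3.
move: h1 h3 h4; rewrite !ler_norml => /andP[h11 h12] /andP[h31 h32] /andP[h41 h42].
rewrite (_ : c ^+ 2 * (M - Rb ^+ 2) = - (P - c ^+ 2 * M) + (P - mbar x * Rb) + (mbar x - c ^+ 2 * Rb) * Rb); last by ring.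
by lra.
Qed.

Definition degenerate_const : R :=
  gamma + (1 + gamma) * ((1 + K) * kap)
  + (2 * K * gamma + K ^+ 2 * gamma * kap + kap + 2 * (kap + K * kap) + 4 * K ^+ 2 * kap).

Lemma trace_small :
  `|(c2 - c ^+ 2) * c * (N%:R^-1 * \tr (row_mass2 A ^+ 2))| <=
  (2 * K * gamma + K ^+ 2 * gamma * kap + kap + 2 * (kap + K * kap) + 4 * K ^+ 2 * kap) * eta.
Proof.
have sw t (ts : List.In t test_families) := avg_swap ts.
have hq := sw (1%N, reduced_field A) ltac:(rewrite /=; tauto) isT.
have hs1 := sw (1%N, self_coef A) ltac:(rewrite /=; tauto) isT.
have hs2 := sw (2%N, self_coef A) ltac:(rewrite /=; tauto) isT.
have hm := sw (1%N, self_mass A) ltac:(rewrite /=; tauto) isT.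
have h1 := sw (1%N, mass_coef A (fun=> 1)) ltac:(rewrite /=; tauto) isT.
move: hq hs1 hs2 hm h1; rewrite /= -/c -/c2.
set xq := avg _; set q := avg (fun k => reduced_field A k x).
set xs := avg _; set s := avg (fun k => self_coef A k x).
set x2s := avg _; set xm := avg (fun k => _ * self_mass A k x).
set sm := avg _; set x1 := avg _; set m1 := avg _ => hq hs1 hs2 hm h1.
have smE : sm = N%:R^-1 * \tr (row_mass2 A ^+ 2) by rewrite /sm /avg (sum_self_mass cA).
(* The sum of the [self_coef] is itself linear in the x_k with coefficients [self_mass], so one more
   swap brings [s] close to [c * sm]. *)
have sE : s = xm.
  by rewrite /s /xm /avg sum_self_coef.
(* Weights whose average is nearly 0, being the swap error [x1 - c * m1]; paired with the fields
   they expose the self-interaction. *)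
pose a i := \sum_l r i l * (tnth x l - c).
have a_le i : `|a i| <= 2 * K * gamma.
  rewrite (le_trans (ler_norm_sum _ _ _))//.
  apply: (@le_trans _ _ (\sum_l 2 * K * r i l)).
    apply: ler_sum => l _; rewrite normrM (ger0_norm (row_mass_ge0 cA _ _)) mulrC.
    rewrite ler_wpM2r ?(row_mass_ge0 cA)// (le_trans (ler_normB _ _))//.
    by rewrite mulr_natl mulr2n lerD// box_norm.
  by rewrite -mulr_sumr ler_wpM2l ?mulr_ge0// gA.
have hma := avg_mean_swap a_le.
have aE : avg a = x1 - c * m1.
  rewrite /a avg_exchange -avgZ -avgB; apply: eq_avg => l.
  rewrite /mass_coef -mulr_suml (eq_bigr (fun i => 1 * r i l)); last by move=> i; rewrite mul1r.
  by ring.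
have maE : avg (fun i => m x i * a i) = (xq - c * q) + 2 * (x2s - c * xs).
  rewrite -!avgZ -!avgB -avgZ -avgD.
  rewrite (eq_avg (G := fun i => \sum_l m x i * (r i l * (tnth x l - c)))); last first.
    by move=> i; rewrite mulr_sumr.
  rewrite avg_exchange; apply: eq_avg => l.
  rewrite (eq_bigr (fun i => (tnth x l - c) * (r i l * m x i))); last by move=> i _; ring.
  by rewrite -mulr_sumr (mass_fieldE cA); ring.
have mb := norm_mean_field.
have kap0 : 0 <= kap by apply: le_trans swap_const_ge1.
have ke0 : 0 <= kap * eta by rewrite mulr_ge0.
have c2_le : `|c2| <= K ^+ 2 by exact: norm_psi.
have cc_le : `|c ^+ 2| <= K ^+ 2 by rewrite normrX lerXn2r ?nnegrE.
have v_le : `|c2 - c ^+ 2| <= 2 * K ^+ 2.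
  by rewrite (le_trans (ler_normB _ _))// mulr_natl mulr2n lerD.
have b1 : `|mbar x * (x1 - c * m1)| <= K ^+ 2 * gamma * (kap * eta) by rewrite normrM ler_pM.
have b2 : `|c * (xs - c * s)| <= K * (kap * eta) by rewrite normrM ler_pM.
have b3 : `|(c2 - c ^+ 2) * (xm - c * sm)| <= 2 * K ^+ 2 * (kap * eta) by rewrite normrM ler_pM.
rewrite -smE; rewrite aE maE in hma; rewrite -sE in b3.
move: hma hq hs2 b1 b2 b3; rewrite !ler_norml.
set E := (c2 - c ^+ 2) * c * sm.
(* [2 * E] is the main term; the left side and all other terms on the right are O(eta). The stated
   constant in fact bounds twice [E]. *)
rewrite (_ : xq - c * q + 2 * (x2s - c * xs) - mbar x * (x1 - c * m1) =
  2 * E + (xq - c * q) + 2 * (x2s - c2 * s) - 2 * (c * (xs - c * s))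
  + 2 * ((c2 - c ^+ 2) * (s - c * sm)) - mbar x * (x1 - c * m1)); last by rewrite /E; ring.
have g2 : 0 <= K * gamma * eta by rewrite !mulr_ge0.
have g3 : 0 <= K ^+ 2 * gamma * kap * eta by rewrite !mulr_ge0 ?exprn_ge0//.
have g4 : 0 <= K * kap * eta by rewrite !mulr_ge0.
have g5 : 0 <= K ^+ 2 * kap * eta by rewrite !mulr_ge0 ?exprn_ge0//.
move=> /andP[? ?] /andP[? ?] /andP[? ?] /andP[? ?] /andP[? ?] /andP[? ?].
by clearbody E; apply/andP; split; lra.
Qed.

End degenerate_bounds.

(** * A lower threshold for T_N, uniform in N *)

Section nondegeneracy.
Context (R : realType) (km kp : R) (mu : probability (measurableTypeR R) R).
Hypotheses (ltk : km < kp) (muB : mu `[km, kp]%classic = 1%E).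
Hypotheses (skm : measure_supp mu km) (skp : measure_supp mu kp).
Variables (b h gamma : R).
Local Notation K := (supp_bound km kp).
Local Notation psi := (psi mu).

Lemma nondegenerate_samples (delta : R) : 0 < delta -> psi 1 h != 0 ->
  exists2 eta : R, 0 < eta &
  forall N (A : 'I_N -> 'I_N -> 'I_N -> R) (x : N.-tuple (measurableTypeR R)),
    (0 < N)%N -> coupling_tensor A ->
    (forall i, \sum_j \sum_k A i j k <= gamma) ->
    (delta <= N%:R^-1 * \tr (row_mass2 A ^+ 2)) \/
      (delta <= N%:R^-1 * \sum_i (row_mass1 A i - mean_row_mass1 A) ^+ 2) ->
    box km kp x -> T_stat A x <= eta ^+ 2 ->
    (N%:R * eta) ^+ 2 < test_stat mu A b h x.
Proof.
have a1 (u w z : R) : 0 <= w -> w * (2 * (u + 1)) <= z -> u * w <= z / 2 by lra.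
have a2 (u w z : R) : 0 <= w -> w * (8 * (u + 1)) <= z -> u * w <= z / 8 by lra.
have a3 (u w z : R) : z <= u + w -> w <= z / 2 -> z / 2 <= u by lra.
have a4 (u w z : R) : 0 < u -> z <= u / 8 -> u / 4 <= w -> w <= z -> False by lra.
move=> d0 psih.
have K1 : 1 <= K := supp_bound_ge1 _ _.
have K0 : 0 <= K by rewrite (le_trans _ K1).
(* This range contains [theta], since |mbar| is at most [K ^+ 2 * gamma]. *)
have [v v0 vP] := var_psi_lb ltk muB skm skp (`|b| * (K ^+ 2 * gamma) + `|h|).
pose C0 := degenerate_const km kp b gamma.
(* One summand for each of the two degree assumptions. The absolute values keep the constant
   nonnegative before the sign of [gamma] is known, which only a tensor with at least one site
   provides. *)
pose C1 : R := `|K * C0 / (v * delta)| + `|C0 / delta|.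
pose C2 : R := 2 * K ^+ 2 * (`|b| * (C1 * `|gamma| + `|C0|)).
pose lam : R := `|psi 1 h|.
have lam0 : 0 < lam by rewrite normr_gt0.
have C0E : C0 = degenerate_const km kp b gamma by [].
have C1d : C1 = `|K * C0 / (v * delta)| + `|C0 / delta| by [].
have C2E : C2 = 2 * K ^+ 2 * (`|b| * (C1 * `|gamma| + `|C0|)) by [].
have lamE : lam = `|psi 1 h| by [].
clearbody lam C2 C1 C0.
have C10 : 0 <= C1 by rewrite C1d addr_ge0.
have C20 : 0 <= C2.
  by rewrite C2E mulr_ge0 ?mulr_ge0 ?exprn_ge0// addr_ge0// mulr_ge0.
(* The first bound makes |c| at least [lam / 2]; the second makes c^2 at most [lam ^+ 2 / 8], below
   [lam ^+ 2 / 4]. *)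
pose eta := Num.min (lam / (2 * (C2 + 1))) (lam ^+ 2 / (8 * (C1 + 1))).
have C21 : 0 < 2 * (C2 + 1) by rewrite mulr_gt0// ltr_wpDl.
have C11 : 0 < 8 * (C1 + 1) by rewrite mulr_gt0// ltr_wpDl.
have eta0 : 0 < eta by rewrite lt_min !divr_gt0// exprn_gt0.
have eta_le1 : eta <= lam / (2 * (C2 + 1)) by rewrite ge_min lexx.
have eta_le2 : eta <= lam ^+ 2 / (8 * (C1 + 1)) by rewrite ge_min lexx orbT.
clearbody eta.
exists eta => // N A x N0 cA gA deg bx Tx.
rewrite ltNge; apply/negP => Sx.
have g0 := gamma_ge0 N0 cA gA.
have eta1 := ltW eta0.
have h1 := mean_field_approx (ltW ltk) muB N0 cA gA bx eta1 Tx Sx.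
have h2 := row_mass_variance_small (ltW ltk) muB N0 cA gA bx eta1 Tx Sx.
have h3 := trace_small (ltW ltk) muB N0 cA gA bx eta1 Tx Sx.
set kap := swap_const km kp b gamma in h1 h2 h3.
have kap0 : 0 <= kap.
  exact: (le_trans ler01 (swap_const_ge1 km kp b gamma)).
have mb := norm_mean_field N0 cA gA bx.
set mbar := mean_field A x in h1 h2 h3 mb.
set c := psi 1 (b * mbar + h) in h1 h2 h3.
have cE : c = psi 1 (b * mbar + h) by [].
have c_le : `|c| <= K by rewrite cE; have := norm_psi muB 1 (b * mbar + h); rewrite expr1.
have vc : v <= psi 2 (b * mbar + h) - c ^+ 2.
  rewrite cE; apply: vP; rewrite (le_trans (ler_normD _ _))// lerD2r normrM ler_wpM2l//.
clearbody c.
have p1 : 0 <= kap * gamma by rewrite mulr_ge0.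
have p2 : 0 <= K * kap by rewrite mulr_ge0.
have p3 : 0 <= K * kap * gamma by rewrite !mulr_ge0.
have p4 : 0 <= K * gamma by rewrite mulr_ge0.
have p5 : 0 <= K ^+ 2 * gamma * kap by rewrite !mulr_ge0 ?exprn_ge0.
have p6 : 0 <= K ^+ 2 * kap by rewrite !mulr_ge0 ?exprn_ge0.
have C0d : C0 = gamma + (1 + gamma) * ((1 + K) * kap)
  + (2 * K * gamma + K ^+ 2 * gamma * kap + kap + 2 * (kap + K * kap) + 4 * K ^+ 2 * kap).
  by rewrite C0E.
clearbody kap.
have [C00 Ca Cb Cc] : [/\ 0 <= C0, (1 + K) * kap <= C0,
    gamma + (1 + gamma) * ((1 + K) * kap) <= C0 &
    2 * K * gamma + K ^+ 2 * gamma * kap + kap + 2 * (kap + K * kap)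
      + 4 * K ^+ 2 * kap <= C0].
  by rewrite C0d; clear - g0 kap0 K0 p1 p2 p3 p4 p5 p6; split; lra.
have {}h1 : `|mbar - c ^+ 2 * mean_row_mass1 A| <= C0 * eta.
  by apply: (le_trans h1); rewrite ler_wpM2r.
have {}h2 : c ^+ 2 * avg (fun i => (row_mass1 A i - mean_row_mass1 A) ^+ 2) <= C0 * eta.
  by apply: (le_trans h2); rewrite ler_wpM2r.
have {}h3 : `|(psi 2 (b * mbar + h) - c ^+ 2) * c *
    (N%:R^-1 * \tr (row_mass2 A ^+ 2))| <= C0 * eta.
  by apply: (le_trans h3); rewrite ler_wpM2r.
have c2C : c ^+ 2 <= C1 * eta.
  have C1E : C1 = K * C0 / (v * delta) + C0 / delta.
    by rewrite C1d !ger0_norm// !mulr_ge0// invr_ge0 ?mulr_ge0// ltW.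
  case: deg => deg.
    have : v * delta * `|c| <= C0 * eta.
      apply: le_trans h3.
      rewrite normrM (normrM _ c) (mulrAC v); apply: ler_pM.
      - by rewrite mulr_ge0// ltW.
      - exact: ltW.
      - by rewrite ler_wpM2r// (le_trans vc)// ler_norm.
      - by rewrite (le_trans deg)// ler_norm.
    rewrite mulrC -ler_pdivlMr ?mulr_gt0// => cC.
    (* The trace relation is linear in [c]. One factor |c| is bounded by [K] to reach the form c^2
       <= C1 eta shared by both cases. *)
    apply: (@le_trans _ _ (K * (C0 * eta / (v * delta)))).
      by rewrite -real_normK ?num_real// expr2 ler_pM.
    rewrite C1E (mulrDl (K * C0 / _)) (_ : K * (C0 * eta / _) = K * C0 / (v * delta) * eta); last by rewrite mulrA mulrA mulrAC.
    by rewrite lerDl mulr_ge0// divr_ge0// ltW.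
  have : c ^+ 2 * delta <= C0 * eta.
    by apply: le_trans h2; rewrite ler_wpM2l ?sqr_ge0.
  rewrite -ler_pdivlMr// => /le_trans; apply.
  rewrite C1E (mulrDl (K * C0 / _)) (mulrAC C0) lerDr.
  by rewrite mulr_ge0// divr_ge0 ?mulr_ge0// ltW.
have Rb : `|mean_row_mass1 A| <= gamma.
  rewrite (le_trans (norm_avg _))// avg_le_cst// => i.
  by rewrite ger0_norm ?gA// (rho_ge0 cA).
have mC : `|mbar| <= (C1 * `|gamma| + `|C0|) * eta.
  rewrite (_ : mbar = c ^+ 2 * mean_row_mass1 A + (mbar - c ^+ 2 * mean_row_mass1 A)); last by ring.
  rewrite (le_trans (ler_normD _ _))// mulrDl lerD//; last by rewrite (ger0_norm C00).
  rewrite normrM (mulrAC C1); apply: ler_pM => //; last by rewrite (ger0_norm g0).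
  by rewrite (ger0_norm (sqr_ge0 c)).
have hC : lam <= `|c| + C2 * eta.
  rewrite lamE (_ : psi 1 h = c + (psi 1 h - c)); last by ring.
  rewrite (le_trans (ler_normD _ _))// lerD2l cE (le_trans (psi_lip muB _ _ _))//.
  rewrite (_ : h - _ = - (b * mbar)); last by ring.
  rewrite normrN normrM C2E -[X in _ <= X]mulrA ler_wpM2l ?mulr_ge0 ?exprn_ge0//.
  by rewrite -[X in _ <= X]mulrA ler_wpM2l.
have e1 : C2 * eta <= lam / 2.
  by apply: a1 => //; rewrite -ler_pdivlMr.
have e2 : C1 * eta <= lam ^+ 2 / 8.
  by apply: a2 => //; rewrite -ler_pdivlMr.
have cl : lam / 2 <= `|c| by apply: a3 hC e1.
have : (lam / 2) ^+ 2 <= `|c| ^+ 2 by rewrite lerXn2r ?nnegrE ?divr_ge0// ltW.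
rewrite real_normK ?num_real// exprMn exprVn -natrX => h4.
exact: (a4 (lam ^+ 2) (c ^+ 2) (C1 * eta) (exprn_gt0 2 lam0) e2 h4 c2C).
Qed.

End nondegeneracy.

(** * Concavity of the log-pseudo-likelihood and uniqueness *)

Section pseudo_likelihood.
Context (R : realType) (km kp : R) (mu : probability (measurableTypeR R) R).
Hypotheses (ltk : km < kp) (muB : mu `[km, kp]%classic = 1%E).
Hypotheses (skm : measure_supp mu km) (skp : measure_supp mu kp).
Variables (N : nat) (A : 'I_N -> 'I_N -> 'I_N -> R) (gamma : R).
Variable x : N.-tuple (measurableTypeR R).
Hypothesis N0 : (0 < N)%N.
Hypothesis cA : coupling_tensor A.
Hypothesis gA : forall i, \sum_j \sum_k A i j k <= gamma.
Hypothesis bx : box km kp x.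
Local Notation K := (supp_bound km kp).
Local Notation psi := (psi mu).
Local Notation m := (local_field A x).

(** The derivative of [pseudo_loglik] at [p] along [d]; the estimating equations say that it
    vanishes in every direction. *)
Definition score (d p : R * R) : R :=
  \sum_i (d.1 * m i + d.2) * (tnth x i - psi 1 (p.1 * m i + p.2)).

Definition pseudo_loglik (p : R * R) : R :=
  \sum_i (tnth x i * (p.1 * m i + p.2) - Lambda mu (p.1 * m i + p.2)).

Lemma pseudo_likelihood_eqsP (p : R * R) :
  pseudo_likelihood_eqs mu A x p.1 p.2 <-> forall d, score d p = 0.
Proof.
rewrite /pseudo_likelihood_eqs.
under eq_bigr do rewrite (derive1_Lambda muB).
under [X in _ /\ X = 0]eq_bigr do rewrite (derive1_Lambda muB).
split=> [[h1 h2] d|h].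
  rewrite /score; under eq_bigr do rewrite mulrDl -mulrA.
  by rewrite big_split /= -!mulr_sumr h1 h2 !mulr0 addr0.
split.
  rewrite -[RHS](h (1, 0)); apply: eq_bigr => i _ /=.
  by rewrite mul1r addr0.
rewrite -[RHS](h (0, 1)); apply: eq_bigr => i _ /=.
by rewrite mul0r add0r mul1r.
Qed.

Lemma scoreZ (a : R) (d p : R * R) : score (a * d.1, a * d.2) p = a * score d p.
Proof. by rewrite /score mulr_sumr; apply: eq_bigr => i _ /=; ring. Qed.

Lemma loglik_concave (p q : R * R) :
  score (q.1 - p.1, q.2 - p.2) q <= pseudo_loglik q - pseudo_loglik p.
Proof.
rewrite /score /pseudo_loglik -sumrB; apply: ler_sum => i _ /=.
have := Lambda_convex ltk muB skm skp (p.1 * m i + p.2) (q.1 * m i + q.2).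
set u := p.1 * m i + p.2; set v := q.1 * m i + q.2.
rewrite (_ : (q.1 - p.1) * m i + (q.2 - p.2) = v - u); last by rewrite /u /v; ring.
move: (Lambda mu u) (Lambda mu v) (psi 1 v) (tnth x i) => L1 L2 s y.
by clearbody u v; lra.
Qed.

(** The Gram form of the regressors (m_i, 1). The Hessian of [- pseudo_loglik] is this form weighted
    by the tilted variances. *)
Definition design (d : R * R) : R := \sum_i (d.1 * m i + d.2) ^+ 2.

Lemma score_lip (d p : R * R) (t : R) : 0 <= t ->
  score d p - t * (2 * K ^+ 2 * design d) <=
  score d (p.1 + t * d.1, p.2 + t * d.2).
Proof.
move=> t0; rewrite /design !mulr_sumr /score -sumrB; apply: ler_sum => i _ /=.
set u := p.1 * m i + p.2; set v := _ * m i + (_ + _); set w := d.1 * m i + d.2.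
have vu : v - u = t * w by rewrite /u /v /w; ring.
have := psi_lip muB 1 u v; rewrite vu normrM (ger0_norm t0) => h.
have : `|w * (psi 1 v - psi 1 u)| <= t * (2 * K ^+ 2 * w ^+ 2).
  rewrite normrM mulrC (le_trans (ler_wpM2r (normr_ge0 w) h))//.
  rewrite (_ : t * (2 * K ^+ 2 * w ^+ 2) = 2 * K ^+ 2 * (t * `|w|) * `|w|)//.
  by rewrite -(real_normK (num_real w)); ring.
rewrite ler_norml => /andP[].
move: (psi 1 u) (psi 1 v) (tnth x i) => s1 s2 y.
by clearbody w; lra.
Qed.

(** The first-order condition is drawn from concavity: by [score_lip] a positive score at [p] would
    persist a little further along [d], and [loglik_concave] at that point would give a strictly
    larger value inside [Q]. *)
Lemma score_at_max (Q : set (R * R)) (p d : R * R) :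
  (forall q, Q q -> pseudo_loglik q <= pseudo_loglik p) ->
  (forall t, 0 <= t <= 1 -> Q (p.1 + t * d.1, p.2 + t * d.2)) ->
  score d p <= 0.
Proof.
move=> pmax pQ; rewrite leNgt; apply/negP => s0.
pose W := 2 * K ^+ 2 * design d.
have W0 : 0 <= W.
  apply: mulr_ge0; first by rewrite mulr_ge0 ?sqr_ge0.
  by apply: sumr_ge0 => i _; exact: sqr_ge0.
have W1 : 0 < W + score d p by rewrite ltr_wpDl.
(* Chosen so that t <= 1 and t W stays strictly below the score at [p], even when [W] is 0. *)
pose t := score d p / (W + score d p) / 2.
have t0 : 0 < t by rewrite !divr_gt0.
have t1 : t <= 1.
  have : score d p / (W + score d p) <= 1 by rewrite ler_pdivrMr// mul1r lerDr.
  by rewrite /t; lra.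
have tW : t * W < score d p.
  apply: (@le_lt_trans _ _ (t * (W + score d p))).
    by rewrite ler_pM2l// lerDl ltW.
  rewrite /t (mulrAC _ 2^-1) divfK ?gt_eqF//.
  by rewrite ltr_pdivrMr// ltr_pMr// ltr1n.
pose q := (p.1 + t * d.1, p.2 + t * d.2).
have Qq : Q q by apply: pQ; rewrite ltW.
have h1 := score_lip d p (ltW t0); rewrite -/q -/W in h1.
have h2 := loglik_concave p q.
rewrite (_ : (q.1 - p.1, q.2 - p.2) = (t * d.1, t * d.2)) ?scoreZ in h2; last first.
  by rewrite /q /=; congr (_, _); ring.
have h3 := pmax _ Qq.
have h4 : 0 < score d q by apply: lt_le_trans h1; rewrite subr_gt0.
have := lt_le_trans (mulr_gt0 t0 h4) h2.
by rewrite subr_gt0 ltNge h3.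
Qed.

Lemma continuous_loglik : continuous pseudo_loglik.
Proof.
have cL : continuous (Lambda mu).
  move=> u; apply/differentiable_continuous/derivable1_diffP.
  exact: (@ex_derive _ _ _ _ _ _ _ (is_derive_Lambda muB u)).
have cl i : continuous (fun p : R * R => p.1 * m i + p.2).
  move=> p; apply: cvgD; last exact: cvg_snd.
  by apply: cvgM; [exact: cvg_fst|exact: cvg_cst].
rewrite /pseudo_loglik; apply: continuous_big => [|i _ p]; first exact: add_continuous.
apply: cvgB.
  by apply: cvgM; [exact: cvg_cst|exact: cl].
apply: (continuous_comp (cl i p)); exact: cL.
Qed.

Lemma norm_field i : `|m i| <= K ^+ 2 * gamma.
Proof.
rewrite (le_trans (norm_qform_le (A i) bx))// ler_wpM2l ?sqr_ge0//.
exact: (row_mass_le cA gA).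
Qed.

(** Centring the m_i at mbar splits [design d] into N (d.1 mbar + d.2)^2 and N d.1^2 T_N. The second
    part controls [d.1]; the first then controls [d.2], because mbar is bounded. *)
Lemma design_lb (t0 : R) (d : R * R) : 0 < t0 -> t0 <= T_stat A x ->
  N%:R * (d.1 ^+ 2 + d.2 ^+ 2) <=
  (2 + (2 * (K ^+ 2 * gamma) ^+ 2 + 1) / t0) * design d.
Proof.
move=> t00 tT; pose mb := mean_field A x; pose T := T_stat A x.
have NR : 0 < N%:R :> R by rewrite ltr0n.
have mb_le : mb ^+ 2 <= (K ^+ 2 * gamma) ^+ 2.
  rewrite -[leLHS]real_normK ?num_real// lerXn2r ?nnegrE//.
    exact: le_trans (norm_field (Ordinal N0)).
  exact: (norm_mean_field N0 cA gA bx).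
have dE : design d = N%:R * ((d.1 * mb + d.2) ^+ 2 + d.1 ^+ 2 * T).
  have -> : design d = N%:R * avg (fun i => (d.1 * m i + d.2) ^+ 2).
    by rewrite /avg mulrA mulfV ?mul1r// gt_eqF.
  congr (_ * _).
  rewrite (eq_avg (G := fun i => (d.1 * mb + d.2) ^+ 2
     + 2 * d.1 * (d.1 * mb + d.2) * (m i - mb) + d.1 ^+ 2 * (m i - mb) ^+ 2)); last first.
    by move=> i; ring.
  rewrite 2!avgD !avgZ avgB !(avg_cst N0).
  rewrite (_ : avg m - mb = 0) ?mulr0 ?addr0//.
  by rewrite /mb /mean_field /avg subrr.
rewrite dE mulrCA ler_pM2l//.
set B := (K ^+ 2 * gamma) ^+ 2 in mb_le *; set e := d.1 * mb + d.2.
have d1 : d.1 ^+ 2 <= d.1 ^+ 2 * T / t0.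
  by rewrite ler_pdivlMr// ler_wpM2l ?sqr_ge0.
have d2 : d.2 ^+ 2 <= 2 * e ^+ 2 + 2 * (d.1 ^+ 2 * mb ^+ 2).
  by have := sqr_ge0 (e + d.1 * mb); rewrite /e; lra.
have d3 : d.1 ^+ 2 * mb ^+ 2 <= d.1 ^+ 2 * T / t0 * B.
  by rewrite ler_pM ?sqr_ge0.
have T0 : 0 <= d.1 ^+ 2 * T by rewrite mulr_ge0 ?sqr_ge0// ltW// (lt_le_trans t00).
have B0 : 0 <= B by rewrite sqr_ge0.
have e0 : 0 <= (2 * B + 1) / t0 * e ^+ 2.
  by rewrite mulr_ge0 ?sqr_ge0// divr_ge0 ?(ltW t00)// addr_ge0// mulr_ge0.
rewrite (_ : (2 + (2 * B + 1) / t0) * (e ^+ 2 + d.1 ^+ 2 * T) =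
  2 * e ^+ 2 + (2 * B + 1) / t0 * e ^+ 2 + 2 * (d.1 ^+ 2 * T)
  + 2 * (d.1 ^+ 2 * T / t0 * B) + d.1 ^+ 2 * T / t0); last by ring.
by lra.
Qed.

Lemma score_diff (d p : R * R) (Th v : R) :
  (forall t, `|t| <= Th -> v <= psi 2 t - psi 1 t ^+ 2) ->
  (forall i, `|p.1 * m i + p.2| <= Th) ->
  (forall i, `|(p.1 + d.1) * m i + (p.2 + d.2)| <= Th) ->
  v * design d <= score d p - score d (p.1 + d.1, p.2 + d.2).
Proof.
move=> vP h1 h2; rewrite /design mulr_sumr /score -sumrB; apply: ler_sum => i _ /=.
have := psi1_mono muB vP (h1 i) (h2 i).
rewrite (_ : _ + _ - _ = d.1 * m i + d.2); last by ring.
move: (d.1 * m i + d.2) (psi 1 _) (psi 1 _) (tnth x i) => w s1 s2 y.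
by lra.
Qed.

(** This uniqueness is global. Monotonicity of [psi 1] makes all terms of the score difference
    nonnegative, so each is 0; injectivity gives d.1 m_i + d.2 = 0 at every site, and [design_lb]
    leaves only d = 0. *)
Lemma mple_unique (t0 : R) (p q : R * R) : 0 < t0 -> t0 <= T_stat A x ->
  (forall d, score d p = 0) -> (forall d, score d q = 0) -> p = q.
Proof.
move=> t00 tT sp sq; pose d := (q.1 - p.1, q.2 - p.2).
have s0 : \sum_i (psi 1 (q.1 * m i + q.2) - psi 1 (p.1 * m i + p.2))
    * ((q.1 * m i + q.2) - (p.1 * m i + p.2)) = 0.
  transitivity (score d p - score d q); last by rewrite sp sq subrr.
  rewrite /score -sumrB.
  by apply: eq_bigr => i _; rewrite /d /=; ring.
have e0 i : d.1 * m i + d.2 = 0.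
  have := psumr_eq0P (fun i _ => psi1_mono_ge0 ltk muB skm skp _ _) s0 => /(_ i isT) h.
  have E : p.1 * m i + p.2 = q.1 * m i + q.2.
    by apply: (psi1_mono_eq ltk muB skm skp); rewrite h.
  rewrite (_ : _ + _ = (q.1 * m i + q.2) - (p.1 * m i + p.2)); last first.
    by rewrite /d /=; ring.
  by rewrite E subrr.
have := design_lb d t00 tT.
rewrite /design big1 ?mulr0 => [|i _]; last by rewrite e0 expr0n.
rewrite pmulr_rle0 ?ltr0n// => dd.
have h1 : d.1 ^+ 2 = 0 by have := sqr_ge0 d.1; have := sqr_ge0 d.2; lra.
have h2 : d.2 ^+ 2 = 0 by have := sqr_ge0 d.1; have := sqr_ge0 d.2; lra.
move/eqP: h1; rewrite sqrf_eq0 subr_eq0 => /eqP h1.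
move/eqP: h2; rewrite sqrf_eq0 subr_eq0 => /eqP h2.
by rewrite (surjective_pairing p) (surjective_pairing q) h1 h2.
Qed.

End pseudo_likelihood.

(** * Existence of the MPLE near the true parameter *)

Section local_mple.
Context (R : realType) (km kp : R) (mu : probability (measurableTypeR R) R).
Hypotheses (ltk : km < kp) (muB : mu `[km, kp]%classic = 1%E).
Hypotheses (skm : measure_supp mu km) (skp : measure_supp mu kp).
Variables (b h gamma : R).
Local Notation K := (supp_bound km kp).
Local Notation psi := (psi mu).

Lemma loglik_max_box N (A : 'I_N -> 'I_N -> 'I_N -> R)
    (x : N.-tuple (measurableTypeR R)) (r : R) : 0 < r ->
  exists p : R * R, [/\ `|p.1 - b| <= r, `|p.2 - h| <= r &
    forall q : R * R, `|q.1 - b| <= r -> `|q.2 - h| <= r ->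
      pseudo_loglik mu A x q <= pseudo_loglik mu A x p].
Proof.
move=> r0.
pose Q : set (R * R) := `[b - r, b + r]%classic `*` `[h - r, h + r]%classic.
have QE q : Q q <-> `|q.1 - b| <= r /\ `|q.2 - h| <= r.
  by rewrite /Q /= !in_itv /= !ler_distl.
have Q0 : Q !=set0 by exists (b, h); apply/QE; rewrite /= !subrr normr0 ltW.
have cQ : compact Q by apply: compact_setX; exact: segment_compact.
have cf : {within Q, continuous (pseudo_loglik mu A x)}.
  exact/continuous_subspaceT/(continuous_loglik muB).
have [p /set_mem/QE[p1 p2] pmax] := compact_EVT_max Q0 cQ cf.
exists p; split; [exact: p1|exact: p2|move=> q q1 q2].
by apply: pmax; apply/mem_set; apply/(QE q).
Qed.

Lemma mple_near (t0 Bd : R) : 0 < t0 -> 0 <= Bd ->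
  exists2 M : R, 0 < M &
  forall N (A : 'I_N -> 'I_N -> 'I_N -> R) (x : N.-tuple (measurableTypeR R)),
    (0 < N)%N -> coupling_tensor A ->
    (forall i, \sum_j \sum_k A i j k <= gamma) ->
    box km kp x -> t0 <= T_stat A x ->
    `|\sum_k resid mu A b h 1 k x * local_field A x k| <= Bd * Num.sqrt N%:R ->
    `|\sum_k resid mu A b h 1 k x * 1| <= Bd * Num.sqrt N%:R ->
    M <= Num.sqrt N%:R ->
    exists b' h', is_mple mu A x b' h' /\
      Num.max `|b' - b| `|h' - h| <= M / Num.sqrt N%:R.
Proof.
move=> t00 Bd0.
pose F := K ^+ 2 * `|gamma|.
have F0 : 0 <= F by rewrite mulr_ge0 ?sqr_ge0.
(* Bounds the tilt at every site for all parameters within 1 of (b, h) in each coordinate. *)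
pose Th := (`|b| + 1) * F + (`|h| + 1).
have [v v0 vP] := var_psi_lb ltk muB skm skp Th.
pose k0 := 2 + (2 * (K ^+ 2 * gamma) ^+ 2 + 1) / t0.
have k00 : 0 <= k0.
  by rewrite addr_ge0// divr_ge0 ?(ltW t00)// addr_ge0// mulr_ge0 ?sqr_ge0.
(* A maximiser on the boundary would give v M <= 2 k0 Bd; the added 1 makes that impossible. *)
pose M := 2 * k0 * Bd / v + 1.
have M0 : 0 < M by rewrite ltr_wpDl// divr_ge0 ?(ltW v0)// !mulr_ge0.
exists M => // N A x N0 cA gA bx tT S1 S2 MN.
have g0 := gamma_ge0 N0 cA gA.
set sN := Num.sqrt N%:R in S1 S2 MN *.
have sN0 : 0 < sN by rewrite (lt_le_trans M0).
have sN2 : sN ^+ 2 = N%:R by rewrite sqr_sqrtr.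
pose r := M / sN.
have r0 : 0 < r by rewrite divr_gt0.
have r1 : r <= 1 by rewrite ler_pdivrMr// mul1r.
have [p [p1 p2 pmax]] := loglik_max_box A x r0.
pose d := (p.1 - b, p.2 - h).
pose Q : set (R * R) := [set q | `|q.1 - b| <= r /\ `|q.2 - h| <= r].
have Qmax q : Q q -> pseudo_loglik mu A x q <= pseudo_loglik mu A x p.
  by move=> [q1 q2]; exact: pmax.
have mF i : `|local_field A x i| <= F.
  by rewrite /F (ger0_norm g0); exact: (norm_field cA gA bx).
have Th_bd (b1 h1 : R) : `|b1 - b| <= 1 -> `|h1 - h| <= 1 ->
    forall i, `|b1 * local_field A x i + h1| <= Th.
  move=> hb hh i; rewrite (le_trans (ler_normD _ _))// lerD//.
    rewrite normrM ler_pM// (_ : b1 = b + (b1 - b)); last by ring.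
    by rewrite (le_trans (ler_normD _ _))// lerD2l.
  rewrite (_ : h1 = h + (h1 - h)); last by ring.
  by rewrite (le_trans (ler_normD _ _))// lerD2l.
(* The box contains the segment from the maximiser [p] to its centre (b, h), so the score at [p]
   towards the centre cannot be positive. *)
have s0 : score mu A x (b - p.1, h - p.2) p <= 0.
  apply: (score_at_max ltk muB skm skp Qmax) => t /andP[t0' t1] /=.
  have t2 : `|1 - t| <= 1 by rewrite ger0_norm; lra.
  split => /=.
    rewrite (_ : _ - b = (1 - t) * (p.1 - b)); last by ring.
    by rewrite normrM -[leRHS]mul1r ler_pM.
  rewrite (_ : _ - h = (1 - t) * (p.2 - h)); last by ring.
  by rewrite normrM -[leRHS]mul1r ler_pM.
have s1 : 0 <= score mu A x d p.
  have := scoreZ mu A x (-1) d p.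
  rewrite (_ : (-1 * d.1, -1 * d.2) = (b - p.1, h - p.2)); last first.
    by rewrite /d /=; congr (_, _); ring.
  by move=> E; rewrite E in s0; lra.
have sd : v * design A x d <= score mu A x d (b, h) - score mu A x d p.
  have := score_diff muB (x := x) (A := A) (d := d) (p := (b, h)) vP.
  rewrite /= (_ : (b + (p.1 - b), h + (p.2 - h)) = p); last first.
    by rewrite [RHS]surjective_pairing; congr (_, _); ring.
  apply; first by apply: Th_bd; rewrite subrr normr0.
  move=> i; rewrite (_ : b + _ = p.1); last by ring.
  rewrite (_ : h + (p.2 - h) = p.2); last by ring.
  by apply: Th_bd; [exact: le_trans p1 r1|exact: le_trans p2 r1].
have sbh : score mu A x d (b, h) <= (`|d.1| + `|d.2|) * (Bd * sN).
  have -> : score mu A x d (b, h) =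
    d.1 * (\sum_k resid mu A b h 1 k x * local_field A x k)
    + d.2 * (\sum_k resid mu A b h 1 k x * 1).
    rewrite !mulr_sumr -big_split /=; apply: eq_bigr => i _.
    by rewrite /resid expr1 /=; ring.
  rewrite (le_trans (ler_norm _))// (le_trans (ler_normD _ _))// (mulrDl `|d.1|).
  by apply: lerD; rewrite normrM; apply: ler_wpM2l.
have dlb := design_lb N0 cA gA bx d t00 tT.
rewrite -/k0 in dlb.
have main : v * (sN ^+ 2 * (d.1 ^+ 2 + d.2 ^+ 2)) <= k0 * ((`|d.1| + `|d.2|) * (Bd * sN)).
  rewrite sN2; apply: (le_trans (ler_wpM2l (ltW v0) dlb)).
  rewrite mulrCA ler_wpM2l//.
  by apply: (le_trans sd); apply: le_trans sbh; rewrite gerBl.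
have noedge : r <= `|d.1| \/ r <= `|d.2| -> False.
  move=> edge.
  have n1 : d.1 ^+ 2 = `|d.1| ^+ 2 by rewrite real_normK ?num_real.
  have n2 : d.2 ^+ 2 = `|d.2| ^+ 2 by rewrite real_normK ?num_real.
  have rsq : r ^+ 2 <= d.1 ^+ 2 + d.2 ^+ 2.
    case: edge => e.
      by rewrite ler_wpDr ?sqr_ge0// n1 lerXn2r ?nnegrE// ltW.
    by rewrite ler_wpDl ?sqr_ge0// n2 lerXn2r ?nnegrE// ltW.
  have rs : `|d.1| + `|d.2| <= 2 * r by rewrite mulr_natl mulr2n lerD.
  have h1 : v * (sN ^+ 2 * r ^+ 2) <= k0 * (2 * r * (Bd * sN)).
    apply: (@le_trans _ _ (v * (sN ^+ 2 * (d.1 ^+ 2 + d.2 ^+ 2)))).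
      by rewrite ler_pM2l// ler_pM2l ?exprn_gt0.
    by rewrite (le_trans main)// ler_wpM2l// ler_wpM2r// mulr_ge0// ltW.
  have rsN : r * sN = M by rewrite /r divfK// gt_eqF.
  have h2 : (v * M) * M <= (2 * k0 * Bd) * M.
    rewrite -rsN (_ : _ * _ * (r * sN) = v * (sN ^+ 2 * r ^+ 2)); last by ring.
    apply: (le_trans h1); rewrite le_eqVlt; apply/orP; left; apply/eqP; ring.
  rewrite ler_pM2r// in h2.
  have h3 : v * M = 2 * k0 * Bd + v by rewrite /M mulrDr mulr1 mulrCA divff ?mulr1// gt_eqF.
  by move: h2; rewrite h3 gerDl leNgt v0.
have i1 : `|d.1| < r by rewrite ltNge; apply/negP => e; apply: noedge; left.
have i2 : `|d.2| < r by rewrite ltNge; apply/negP => e; apply: noedge; right.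
have sle e : score mu A x e p <= 0.
  (* Shrinks the direction [e] to fit the margin left by the strict inequalities; the added 1 keeps
     the denominators positive. *)
  pose a := Num.min ((r - `|d.1|) / (`|e.1| + 1)) ((r - `|d.2|) / (`|e.2| + 1)).
  have e1 : 0 < `|e.1| + 1 by rewrite ltr_wpDl.
  have e2 : 0 < `|e.2| + 1 by rewrite ltr_wpDl.
  have a0 : 0 < a by rewrite lt_min !divr_gt0 ?subr_gt0.
  rewrite -(pmulr_rle0 _ a0) -scoreZ.
  apply: (score_at_max ltk muB skm skp Qmax) => t /andP[t0' t1] /=.
  have tbd (u w : R) : `|u| < r -> a <= (r - `|u|) / (`|w| + 1) -> `|u + t * (a * w)| <= r.
    have w0 : 0 < `|w| + 1 by rewrite ltr_wpDl.
    rewrite ler_pdivlMr// => ur aw.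
    rewrite (le_trans (ler_normD _ _))// !normrM (ger0_norm t0') (gtr0_norm a0).
    have aw0 : 0 <= a * `|w| by rewrite mulr_ge0// ltW.
    have : t * (a * `|w|) <= 1 * (a * `|w|) by rewrite ler_wpM2r.
    move=> h1; rewrite -lerBrDl; apply: (le_trans h1); rewrite mul1r.
    by apply: le_trans aw; rewrite mulrDr mulr1 lerDl ltW.
  split => /=.
    rewrite (_ : _ - b = d.1 + t * (a * e.1)); last by rewrite /d /=; ring.
    by apply: tbd => //; rewrite ge_min lexx.
  rewrite (_ : _ - h = d.2 + t * (a * e.2)); last by rewrite /d /=; ring.
  by apply: tbd => //; rewrite ge_min lexx orbT.
have sc e : score mu A x e p = 0.
  apply/eqP; rewrite eq_le sle /=.
  by have := sle (-1 * e.1, -1 * e.2); rewrite scoreZ mulN1r oppr_le0.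
exists p.1, p.2; split; last by rewrite ge_max p1 p2.
split; first exact/(pseudo_likelihood_eqsP muB).
move=> b' h' /(pseudo_likelihood_eqsP muB A x (b', h')) sc'.
have <- := mple_unique ltk muB skm skp N0 cA gA bx t00 tT sc' sc.
by [].
Qed.

End local_mple.

(** * Limits and linear growth *)

Section asymptotic_bounds.
Context (R : realType).

Lemma cvge_squeeze (f : nat -> \bar R) (l : R) :
  (forall e : R, 0 < e -> \forall N \near \oo,
    ((l - e)%:E <= f N)%E /\ (f N <= (l + e)%:E)%E) ->
  f N @[N --> \oo] --> l%:E.
Proof.
move=> fl; have ffin e : 0 < e -> \forall N \near \oo,
    f N \is a fin_num /\ `|l - fine (f N)| <= e.
  move=> /fl; apply: filterS => N; case: (f N) => [r| |] [] //.
  rewrite !lee_fin => h1 h2; split => //.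
  by rewrite ler_distl; apply/andP; split; rewrite /=; lra.
apply/fine_cvgP; split.
  by apply: filterS (ffin _ ltr01) => N [].
by apply/cvgrPdist_le => e /ffin; apply: filterS => N [].
Qed.

Lemma Omega_linear_lb (a : nat -> R) : Omega_linear a ->
  exists2 delta : R, 0 < delta & \forall N \near \oo, delta <= N%:R^-1 * a N.
Proof.
rewrite /Omega_linear limn_einf_lim (cvg_lim _ (@cvg_einfs_sup _ _))//.
move=> /ereal_sup_gt[_ [n _ <-]]; set y := einfs _ n => y0.
have [delta d0 dy] : exists2 delta : R, 0 < delta & (delta%:E <= y)%E.
  (* The tail infimum may be infinite, in which case 1 serves as [delta]. *)
  case: y y0 => [r| |] //=; last by exists 1; rewrite ?leey.
  by rewrite lte_fin => r0; exists r.
exists delta => //; exists n => // k /= nk.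
rewrite -lee_fin mulrC; apply: (le_trans dy).
by apply: ereal_inf_lbound; exists k.
Qed.

Lemma near_infty_div (c e : R) : 0 < e -> \forall N \near \oo, c / N%:R <= e.
Proof.
move=> e0; near=> N.
have N0 : 0 < N%:R :> R by rewrite ltr0n; near: N; exact: nbhs_infty_gt.
rewrite ler_pdivrMr// mulrC -ler_pdivrMr//.
by near: N; exact: nbhs_infty_ger.
Unshelve. all: by end_near. Qed.

End asymptotic_bounds.

(** * Probability of bad samples *)

Section gibbs_bounds.
Context (R : realType) (km kp : R) (mu : probability (measurableTypeR R) R).
Hypotheses (ltk : km < kp) (muB : mu `[km, kp]%classic = 1%E).
Variables (N : nat) (A : 'I_N -> 'I_N -> 'I_N -> R) (b h gamma : R).
Hypothesis N0 : (0 < N)%N.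
Hypothesis cA : coupling_tensor A.
Hypothesis gA : forall i, \sum_j \sum_k A i j k <= gamma.
Local Notation K := (supp_bound km kp).
Local Notation tT := (N.-tuple (measurableTypeR R)).
Local Notation box := (@box R km kp N).
Local Notation gexp := (gexp mu A b h).
Local Notation gibbs := (gibbs mu A b h).
Local Notation resid := (resid mu A b h).
Local Notation test_stat := (test_stat mu A b h).

(** Seven of the test families carry the power 1 and one the power 2. *)
Definition test_const : R :=
  7 * resid_const km kp b gamma 1 (coef_bound km kp gamma)
  + resid_const km kp b gamma 2 (coef_bound km kp gamma).

Lemma gexp_sqr_resid p C g : slowly_varying km kp C g ->
  bmf box (fun x => (\sum_k resid p k x * g k x) ^+ 2) /\
  gexp (fun x => (\sum_k resid p k x * g k x) ^+ 2) <= resid_const km kp b gamma p C * N%:R.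
Proof.
move=> sv; split; last exact: (gexp_sum_resid (ltW ltk) muB b h cA gA p sv).
case: sv => [g1 _ _ _]; apply: bmfX; apply: bmf_sum => k.
by apply: bmfM => //; exact: bmf_resid.
Qed.

Lemma gexp_test_stat : bmf box test_stat /\ gexp test_stat <= test_const * N%:R.
Proof.
have -> : test_const = \sum_(t <- test_families A)
    resid_const km kp b gamma t.1 (coef_bound km kp gamma).
  by rewrite !big_cons big_nil /test_const /=; ring.
rewrite /test_stat.
have := fun t => slowly_varying_test (ltW ltk) N0 cA gA (t := t).
elim: (test_families A) => [_|t s IH sv].
  under eq_fun do rewrite big_nil; rewrite big_nil mul0r (gexp_cst muB).
  by split => //; exact: bmf_cst.
have [bt et] := gexp_sqr_resid t.1 (sv t (or_introl erefl)).
have [bs es] := IH (fun u us => sv u (or_intror us)).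
under eq_fun do rewrite big_cons; split; first exact: bmfD.
by rewrite big_cons mulrDl (gexpD muB)// lerD.
Qed.

Lemma bmf_T_stat : bmf box (T_stat A).
Proof.
have bm := bmf_local_field km kp A.
apply: bmfM; first exact: bmf_cst.
apply: bmf_sum => i; apply/bmfX/bmfB => //.
by apply: bmfM; [exact: bmf_cst|exact: bmf_sum].
Qed.

Variables (eta Bd : R).

Definition good_sample (x : tT) : Prop :=
  [/\ box x, eta ^+ 2 < T_stat A x,
      `|\sum_k resid 1 k x * local_field A x k| <= Bd * Num.sqrt N%:R &
      `|\sum_k resid 1 k x * 1| <= Bd * Num.sqrt N%:R].

(** The residual sums weighted by m_k and by 1 are the two estimating equations evaluated at the
    true parameter. *)
Definition score_const : R :=
  resid_const km kp b gamma 1 (4 * K ^+ 2 * gamma) + resid_const km kp b gamma 1 1.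

Lemma measurable_sublevel (f : tT -> R) (c : R) : measurable_fun setT f ->
  measurable [set x | f x <= c].
Proof.
move=> mf; rewrite -[X in measurable X]setTI.
rewrite (_ : [set x | _] = f @^-1` `]-oo, c]%classic).
  by apply: mf => //; exact: measurable_itv.
by apply/seteqP; split => x /=; rewrite in_itv.
Qed.

(** Markov's inequality. A small T_N forces [test_stat] above (N eta)^2 while its mean is O(N),
    which costs O(1/N). The score sums are only known to be of order sqrt N, so their share does not
    decay in N and is made small through [Bd]. *)
Lemma gibbs_bad_sample : 0 < eta -> 0 < Bd ->
  (forall x, box x -> T_stat A x <= eta ^+ 2 -> (N%:R * eta) ^+ 2 < test_stat x) ->
  measurable [set x | good_sample x] /\
  (gibbs (~` [set x | good_sample x]) <=
   ((test_const / eta ^+ 2) / N%:R + score_const / Bd ^+ 2)%:E)%E.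
Proof.
move=> eta0 Bd0 degen.
have NR : 0 < N%:R :> R by rewrite ltr0n.
have [bt et] := gexp_test_stat.
have [b1 e1] := gexp_sqr_resid 1 (slowly_varying_local_field (ltW ltk) cA gA).
have c1 : forall l : 'I_N, `|(fun=> 1 : R) l| <= 1 by move=> l; rewrite normr1.
have [b2 e2] := gexp_sqr_resid 1 (slowly_varying_cst km kp c1).
set S1 := fun x : tT => \sum_k resid 1 k x * local_field A x k.
set S2 := fun x : tT => \sum_k resid 1 k x * 1.
have sq (S : tT -> R) x : (`|S x| <= Bd * Num.sqrt N%:R) = (S x ^+ 2 <= Bd ^+ 2 * N%:R).
  rewrite -[S x ^+ 2]real_normK ?num_real// -[N%:R in RHS]sqr_sqrtr ?ler0n//.
  by rewrite -exprMn ler_pXn2r// nnegrE// mulr_ge0// ltW.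
have mgood : measurable [set x | good_sample x].
  rewrite (_ : [set x | _] = box `&` ~` [set x | T_stat A x <= eta ^+ 2] `&`
    ([set x | S1 x ^+ 2 <= Bd ^+ 2 * N%:R] `&` [set x | S2 x ^+ 2 <= Bd ^+ 2 * N%:R])).
    apply: measurableI; apply: measurableI.
    - exact: (measurable_box muB).
    - by apply: measurableC; apply: (measurable_sublevel (f := T_stat A)); case: bmf_T_stat.
    - by apply: (measurable_sublevel (f := fun x => S1 x ^+ 2)); case: b1.
    - by apply: (measurable_sublevel (f := fun x => S2 x ^+ 2)); case: b2.
  apply/seteqP; split => x /=.
    move=> [bx Tx h1 h2]; split; split => //; last 2 first.
    - by rewrite -sq.
    - by rewrite -sq.
    by apply/negP; rewrite -ltNge.
  move=> [[bx /negP Tx] [h1 h2]]; rewrite -ltNge in Tx.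
  by split => //; [rewrite -sq in h1|rewrite -sq in h2].
split => //.
(* At least 1 on every bad sample of the box: the first term when T_N is small, the second when a
   score sum is too large. *)
pose F x := ((N%:R * eta) ^+ 2)^-1 * test_stat x
  + (Bd ^+ 2 * N%:R)^-1 * (S1 x ^+ 2 + S2 x ^+ 2).
have q1 : 0 < (N%:R * eta) ^+ 2 by rewrite exprn_gt0// mulr_gt0.
have q2 : 0 < Bd ^+ 2 * N%:R by rewrite mulr_gt0// exprn_gt0.
have t0 x : 0 <= test_stat x by apply: sumr_ge0 => t _; exact: sqr_ge0.
have b12 : bmf box (fun x => S1 x ^+ 2 + S2 x ^+ 2) by exact: bmfD.
have bF1 : bmf box (fun x => ((N%:R * eta) ^+ 2)^-1 * test_stat x).
  by apply: bmfM => //; exact: bmf_cst.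
have bF2 : bmf box (fun x => (Bd ^+ 2 * N%:R)^-1 * (S1 x ^+ 2 + S2 x ^+ 2)).
  by apply: bmfM => //; exact: bmf_cst.
have p1 x : 0 <= ((N%:R * eta) ^+ 2)^-1 * test_stat x.
  by rewrite mulr_ge0// invr_ge0 ltW.
have p2 x : 0 <= (Bd ^+ 2 * N%:R)^-1 * (S1 x ^+ 2 + S2 x ^+ 2).
  by rewrite mulr_ge0 ?addr_ge0 ?sqr_ge0// invr_ge0 ltW.
apply: (le_trans (gibbs_le_gexp muB A b h (F := F) (measurableC mgood) _ _ _)).
- exact: bmfD.
- move=> x bx ngood.
  have [Tx|Tx] := leP (T_stat A x) (eta ^+ 2).
    rewrite /F ler_wpDr// mulrC ler_pdivlMr// mul1r ltW//.
    exact: degen.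
  rewrite /F ler_wpDl// mulrC ler_pdivlMr// mul1r.
  have [h1|h1] := leP (S1 x ^+ 2) (Bd ^+ 2 * N%:R); last first.
    by rewrite ler_wpDr ?sqr_ge0// ltW.
  have [h2|h2] := leP (S2 x ^+ 2) (Bd ^+ 2 * N%:R); last first.
    by rewrite ler_wpDl ?sqr_ge0// ltW.
  by exfalso; apply: ngood; split => //; [rewrite -sq in h1|rewrite -sq in h2].
- by move=> x _; rewrite addr_ge0.
rewrite lee_fin (gexpD muB)// !(gexpZ muB)// (gexpD muB)//; apply: lerD.
  rewrite mulrC ler_pdivrMr// (le_trans et)//.
  rewrite exprMn (_ : _ * (_ * _) = test_const * N%:R); first exact: lexx.
  by field; rewrite !gt_eqF.
rewrite mulrC ler_pdivrMr//.
rewrite (_ : _ / _ * _ = score_const * N%:R); last by field; rewrite gt_eqF.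
by rewrite mulrDl lerD.
Qed.

End gibbs_bounds.

(** * Choice of thresholds and passage to the limit *)

Unset Implicit Arguments.

Theorem theorem1p4 (R : realType) (km kp : R)
    (mu : probability (measurableTypeR R) R)
    (A : forall N : nat, 'I_N -> 'I_N -> 'I_N -> R) (b0 h0 gamma : R) :
  km < kp ->
  mu `[km, kp]%classic = 1%E ->
  measure_supp mu km ->
  measure_supp mu kp ->
  (forall N, coupling_tensor (A N)) ->
  0 < gamma ->
  (forall N (i : 'I_N), \sum_j \sum_k A N i j k <= gamma) ->
  (Omega_linear (fun N => \tr (row_mass2 (A N) ^+ 2)) \/
   Omega_linear (fun N =>
     \sum_i (row_mass1 (A N) i - mean_row_mass1 (A N)) ^+ 2)) ->
  derive1 (Lambda mu) h0 <> 0 ->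
  T_stat_Omega_p mu A b0 h0 /\ mple_sqrt_consistent mu A b0 h0.
Proof.
move=> ltk muB skm skp cA g0 gA deg /eqP; rewrite (derive1_Lambda muB) => psih.
have [delta d0 near_deg] : exists2 delta : R, 0 < delta & \forall N \near \oo,
    (delta <= N%:R^-1 * \tr (row_mass2 (A N) ^+ 2)) \/
    (delta <= N%:R^-1 * \sum_i (row_mass1 (A N) i - mean_row_mass1 (A N)) ^+ 2).
  case: deg => /Omega_linear_lb[delta d0 hd]; exists delta => //.
    by apply: filterS hd => N; left.
  by apply: filterS hd => N; right.
(* [eta] is fixed once and for all; only [Bd] will depend on the error level. *)
have [eta eta0 degen] := nondegenerate_samples ltk muB skm skp b0 gamma d0 psih.
pose good Bd N : set (N.-tuple (measurableTypeR R)) :=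
  [set x | good_sample km kp mu (A N) b0 h0 eta Bd x].
have bad e : 0 < e -> exists2 Bd : R, 0 < Bd & \forall N \near \oo,
    [/\ (0 < N)%N, measurable (good Bd N) &
      (gibbs mu (A N) b0 h0 (~` good Bd N) <= e%:E)%E].
  move=> e0; have e20 : 0 < e / 2 by rewrite divr_gt0.
  pose sc := score_const km kp b0 gamma.
  (* As [Bd] is at least 1, its square is at least [Bd], which brings [sc / Bd ^+ 2] below [e / 2];
     the other half of [e] absorbs the O(1/N) term. *)
  pose Bd := `|sc| / (e / 2) + 1.
  have Bd1 : 1 <= Bd by rewrite lerDr divr_ge0// ltW.
  have Bd0 : 0 < Bd by exact: lt_le_trans Bd1.
  have scB : sc / Bd ^+ 2 <= e / 2.
    rewrite ler_pdivrMr ?exprn_gt0// (le_trans (ler_norm sc))//.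
    apply: (@le_trans _ _ (e / 2 * Bd)).
      by rewrite /Bd mulrDr mulr1 mulrCA divff ?gt_eqF// mulr1 lerDl ltW.
    by rewrite ler_pM2l// expr2 ler_peMr// ltW.
  exists Bd => //; near=> N.
  have N0 : (0 < N)%N by near: N; exact: nbhs_infty_gt.
  have degN : (delta <= N%:R^-1 * \tr (row_mass2 (A N) ^+ 2)) \/
    (delta <= N%:R^-1 * \sum_i (row_mass1 (A N) i - mean_row_mass1 (A N)) ^+ 2).
    by near: N.
  have [mgood badN] := gibbs_bad_sample ltk muB N0 (cA N) (gA N) eta0 Bd0
    (fun x => degen N (A N) x N0 (cA N) (gA N) degN).
  split => //; apply: (le_trans badN); rewrite lee_fin -/sc (splitr e) lerD//.
  by near: N; exact: near_infty_div.
have consistent d : 0 < d -> exists M : R, \forall N \near \oo,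
    ((1 - d)%:E <= gibbs mu (A N) b0 h0
       [set x | exists b h, is_mple mu (A N) x b h /\
          (Num.max `|b - b0| `|h - h0| <= M / Num.sqrt N%:R)%R])%E.
  move=> /bad[Bd Bd0 badN].
  have [M M0 near_mple] := mple_near ltk muB skm skp b0 h0 gamma
    (exprn_gt0 2 eta0) (ltW Bd0).
  exists M; near=> N.
  have [N0 mgood gbad] : [/\ (0 < N)%N, measurable (good Bd N) &
      (gibbs mu (A N) b0 h0 (~` good Bd N) <= d%:E)%E] by near: N.
  have MN : M <= Num.sqrt N%:R.
    rewrite -(ger0_norm (ltW M0)) -sqrtr_sqr ler_wsqrtr//.
    by near: N; exact: nbhs_infty_ger.
  apply: (@le_trans _ _ (gibbs mu (A N) b0 h0 (good Bd N))).
    move: gbad; rewrite (gibbs_setC muB)// (gibbs_measurable muB)// -EFinB !lee_fin.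
    by rewrite lerBlDr lerBlDl addrC.
  apply: (le_gibbs muB) => x [bx Tx S1 S2].
  exact: (near_mple N (A N) x N0 (cA N) (gA N) bx (ltW Tx) S1 S2 MN).
split; last split => //.
- move=> eps eps0; apply: cvge_squeeze => e e0.
  have [Bd _ badN] := bad e e0; near=> N; split.
    rewrite sub0r; apply: (@le_trans _ _ 0%E).
      by rewrite lee_fin oppr_le0 ltW.
    by apply: integral_ge0 => x _; rewrite lee_fin (weight_ge0 muB).
  rewrite add0r.
  have [_ _ gbad] : [/\ (0 < N)%N, measurable (good Bd N) &
      (gibbs mu (A N) b0 h0 (~` good Bd N) <= e%:E)%E] by near: N.
  (* Once [eps N] is at most [eta ^+ 2], a sample with T_N at most [eps N] violates the lower bound
     on T_N required of good samples. *)
  apply: le_trans gbad; apply: (le_gibbs muB) => x /= Tx [_ + _ _].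
  apply/negP; rewrite -leNgt (le_trans Tx)//.
  near: N; move/cvgrPdist_le : eps0 => /(_ (eta ^+ 2) (exprn_gt0 2 eta0)).
  by apply: filterS => N; rewrite sub0r normrN => /(le_trans (ler_norm _)).
- apply: cvge_squeeze => e e0.
  (* Existence follows from the rate statement at each level [e], since every sample counted there
     has an MPLE. *)
  have [M MN] := consistent e e0; apply: filterS MN => N hN; split.
    apply: (le_trans hN); apply: (le_gibbs muB) => x [b [h [xbh _]]].
    by exists b, h.
  by apply: (le_trans (gibbs_le1 muB _ _ _ _)); rewrite lee_fin lerDl ltW.
Unshelve. all: by end_near.
Qed.
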